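(* Let $A$ be a Boolean algebra. The following are equivalent. (1) $A$ is weakly projective. (2) There is a $\pi$-base $X\subseteq A^{+}$ of $A$, closed under non-zero meets, which carries a coherent finite-separation map, i.e. there exists a coherent finite-separation map $s\colon X\to [X]^{<\omega}$.
   Context: Boolean algebras are written $(A,\vee,\wedge,-,0,1)$ and satisfy $0\neq 1$. Write $A^{+}=A\setminus\{0\}$, and $[X]^{<\omega}$ for the set of finite subsets of $X$. A Boolean algebra $A$ is projective if for every surjective homomorphism $g\colon C\to B$ of Boolean algebras and every homomorphism $h\colon A\to B$ there is a homomorphism $k\colon A\to C$ with $g\circ k=h$. Two Boolean algebras are co-complete if their Boolean completions are isomorphic. A Boolean algebra is weakly projective if it is co-complete with a projective Boolean algebra. A set $X\subseteq A^{+}$ is a $\pi$-base of $A$ if for every $a\in A^{+}$ there is $x\in X$ with $x\leqslant a$. $X$ is closed under non-zero meets if $a,b\in X$ and $a\wedge b\neq 0$ imply $a\wedge b\in X$. For a finite $F\subseteq A$ put $F^{\wedge}=\{\bigwedge G:\emptyset\neq G\subseteq F\}\setminus\{0\}$. Let $X\subseteq A^{+}$ be closed under non-zero meets. A map $s\colon X\to[X]^{<\omega}$ is a finite-separation map if for all $a,b\in X$ with $a\wedge b=0$ there are $c,d\in s(a)\cap s(b)$ with $c\wedge d=0$, $a\leqslant c$ and $b\leqslant d$. It is coherent if, in addition, $s(a\wedge b)\subseteq (s(a)\cup s(b))^{\wedge}$ for all $a,b\in X$ with $a\wedge b>0$. *)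

(* Defs.v *)
From HB Require Import structures.
From mathcomp Require Import all_boot all_order finmap.
From mathcomp Require Import all_classical.

Set Implicit Arguments.
Unset Strict Implicit.
Unset Printing Implicit Defensive.

Import Order.Theory Order.LatticeSyntax.
Local Open Scope order_scope.

(* Boolean algebras are complemented bounded distributive lattices
   [ctbDistrLatticeType d] that are [nondegenerate]: the library's structure
   also admits the one-element lattice. *)
Definition nondegenerate d (A : ctbDistrLatticeType d) : Prop :=
  \bot != \top :> A.

(* The library's [{tblmorphism A -> B}] only preserves [\bot] and [\top], and
   [{lmorphism A -> B}] only binary joins and meets. *)
Definition homomorphism dA (A : ctbDistrLatticeType dA)
    dB (B : ctbDistrLatticeType dB) (f : A -> B) : Prop :=
  [/\ {morph f : x y / x `|` y}, {morph f : x y / x `&` y},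
      {morph f : x / ~` x}, f \bot = \bot & f \top = \top].

Definition projective dA (A : ctbDistrLatticeType dA) : Prop :=
  forall dC (C : ctbDistrLatticeType dC) dB (B : ctbDistrLatticeType dB),
  nondegenerate C -> nondegenerate B ->
  forall (g : C -> B) (h : A -> B),
  homomorphism g -> (forall b : B, exists c : C, g c = b) -> homomorphism h ->
  exists2 k : A -> C, homomorphism k & forall a : A, g (k a) = h a.

Definition complete d (B : ctbDistrLatticeType d) : Prop :=
  forall S : set B, (supremums S !=set0 /\ infimums S !=set0)%classic.

Definition pi_base d (A : ctbDistrLatticeType d) (X : set A) : Prop :=
  (forall x, X x -> x != \bot) /\
  (forall a : A, a != \bot -> exists2 x, X x & x <= a).

(* [e] exhibits [B] as a completion of [A]: [B] is complete and [e] embeds [A]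
   in [B] as a dense subalgebra. *)
Definition is_completion dA (A : ctbDistrLatticeType dA)
    dB (B : ctbDistrLatticeType dB) (e : A -> B) : Prop :=
  [/\ complete B, homomorphism e, injective e &
      pi_base (e @` [set a | a != \bot])%classic].

Definition isomorphic dA (A : ctbDistrLatticeType dA)
    dB (B : ctbDistrLatticeType dB) : Prop :=
  exists2 f : A -> B, homomorphism f & bijective f.

(* A completion exists and is unique up to isomorphism, so it does not matter
   which completions of [A] and of [B] are compared. *)
Definition cocomplete dA (A : ctbDistrLatticeType dA)
    dB (B : ctbDistrLatticeType dB) : Prop :=
  exists dA' (A' : ctbDistrLatticeType dA') (eA : A -> A'),
  exists dB' (B' : ctbDistrLatticeType dB') (eB : B -> B'),
  [/\ is_completion eA, is_completion eB & isomorphic A' B'].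

Definition weakly_projective dA (A : ctbDistrLatticeType dA) : Prop :=
  exists dP (P : ctbDistrLatticeType dP),
  [/\ nondegenerate P, projective P & cocomplete A P].

Definition nonzero_meet_closed d (A : ctbDistrLatticeType d) (X : set A) : Prop :=
  forall a b, X a -> X b -> a `&` b != \bot -> X (a `&` b).

(* The set of non-zero meets of non-empty subsets of [F]. *)
Definition nonzero_meets d (A : ctbDistrLatticeType d) (F : {fset A}) : set A :=
  [set x | x != \bot /\
     exists G : {fset A},
       [/\ G != fset0, (G `<=` F)%fset & x = \meet_(y <- G) y]]%classic.

(* A map from [X] to the finite subsets of [X] is represented by a function on
   all of [A], whose values outside [X] are irrelevant. *)
Definition finite_separation d (A : ctbDistrLatticeType d) (X : set A)
    (s : A -> {fset A}) : Prop :=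
  (forall a, X a -> forall c, c \in s a -> X c) /\
  (forall a b, X a -> X b -> a `&` b = \bot ->
     exists c d, [/\ c \in (s a `&` s b)%fset, d \in (s a `&` s b)%fset,
                     c `&` d = \bot, a <= c & b <= d]).

Definition coherent_finite_separation d (A : ctbDistrLatticeType d)
    (X : set A) (s : A -> {fset A}) : Prop :=
  finite_separation X s /\
  (forall a b, X a -> X b -> a `&` b != \bot ->
     forall c, c \in s (a `&` b) -> nonzero_meets (s a `|` s b)%fset c).

(* Main.v *)
(* Both directions go through one construction.  Let B be a Boolean algebra in
   which every member of a family g of generators comes with countably many
   others, and call a set S of generators closed if it contains the companions
   of its members; B(S) is the algebra generated by S.  Call B rich if, for S
   and T closed, finite meets t of members of T have an upper projection to
   B(S) that lies in the completions of both B(S) and B(T), and if antichains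
   of finite meets are sigma-bounded, so that every element has countable
   support.  A projective algebra is rich, being a retract of a free algebra,
   where finitely supported clopen sets can be projected.  A coherent
   finite-separation map s on X makes the algebra rich with respect to X: the
   projection of t to B(S) is the complement of the join of the finitely many
   c in s(t) and B(S) that are disjoint from t.

   If A is dense in the completion of a rich algebra, Zorn's lemma yields a
   pi-base of A with a coherent finite-separation map: to pass from S to its
   union with a countable closed set, adjoin a tree of finite partitions in A
   whose nodes have a projection to B(S) in the base already built, and let
   s(d /\ q), for d in this base below the projection of the node q, consist of
   s(d) and all the nodes up to the level of q.  The complement of each member
   of this base is moreover a finite join of members.  Such a base generates a
   projective algebra, dense in A: a part of the base that is closed under s
   and under complements in this sense generates a relatively complete
   subalgebra, so liftings extend to countably many further generators, and
   Zorn's lemma applies again. *)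

From HB Require Import structures.
Require Import Defs.
From mathcomp Require Import all_boot all_order finmap.
From mathcomp Require Import all_classical.

Set Implicit Arguments.
Unset Strict Implicit.
Unset Printing Implicit Defensive.

Import Order.Theory Order.LatticeSyntax.
Local Open Scope order_scope.

(** * Ultrafilters *)

(** An ultrafilter is given by its characteristic function, a homomorphism to [bool]; preservation
    of joins and bounds follows. *)
Definition ultra d (A : ctbDistrLatticeType d) (u : A -> bool) : Prop :=
  {morph u : x y / x `&` y >-> x && y} /\ {morph u : x / ~` x >-> ~~ x}.

Section Ultra.
Context d (A : ctbDistrLatticeType d).
Implicit Types (x y z : A) (u : A -> bool).

Section Morphism.
Context u (hu : ultra u).

Lemma ultraI x y : u (x `&` y) = u x && u y. Proof. exact: hu.1. Qed.
Lemma ultraC x : u (~` x) = ~~ u x. Proof. exact: hu.2. Qed.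

Lemma ultraU x y : u (x `|` y) = u x || u y.
Proof.
by rewrite -[x `|` y]complK complU ultraC ultraI !ultraC negb_and !negbK.
Qed.

Lemma ultra0 : u \bot = false.
Proof. by rewrite -(meetxC \top) ultraI ultraC andbN. Qed.

Lemma ultra1 : u \top = true.
Proof. by rewrite -compl0 ultraC ultra0. Qed.

Lemma ultra_le x y : x <= y -> u x ==> u y.
Proof. by move=> /meet_idPl <-; rewrite ultraI; case: (u x); case: (u y). Qed.

Lemma ultra_meets (l : seq A) : u (\meet_(i <- l) i) = all u l.
Proof. by elim: l => [|a l IH]; rewrite ?big_nil ?ultra1// big_cons ultraI IH. Qed.

Lemma ultra_joins (l : seq A) : u (\join_(i <- l) i) = has u l.
Proof. by elim: l => [|a l IH]; rewrite ?big_nil ?ultra0// big_cons ultraU IH. Qed.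

End Morphism.

(* A maximal set of elements with the finite intersection property is an
   ultrafilter. *)
Lemma exists_ultra x : x != \bot -> exists2 u, ultra u & u x.
Proof.
move=> x0.
pose fip (F : set A) := forall l : seq A, (forall a, a \in l -> F a) ->
  x `&` \meet_(i <- l) i != \bot.
have fipU (C : set (set A)) : (C `<=` fip)%classic -> total_on C subset ->
    fip (\bigcup_(F in C) F)%classic.
  move=> Cfip Ctot l lC.
  case: (pselect (exists F, C F)) => [[F0 CF0]|nC]; last first.
    case: l lC => [_|a l lC]; first by rewrite big_nil meetx1.
    by case: (lC a (mem_head _ _)) => F CF; case: nC; exists F.
  suff [F CF lF] : exists2 F, C F & forall a, a \in l -> F a by exact: (Cfip F).
  elim: l lC => [|a l IH] lC; first by exists F0.
  have [F CF lF] := IH (fun b bl => lC b (mem_behead (s := a :: l) bl)).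
  have [G CG aG] := lC a (mem_head _ _).
  have [FG|GF] := Ctot _ _ CF CG.
    by exists G => // b; rewrite inE => /orP[/eqP->|/lF/FG].
  by exists F => // b; rewrite inE => /orP[/eqP->|/lF]; first exact: GF.
have [F [Ffip Fmax]] := Zorn_bigcup fipU.
(* By maximality, an element stays out of [F] only because finitely many members of [F], together
   with [x], exclude it. *)
have notF a : ~ F a -> exists l : seq A,
    (forall b, b \in l -> F b) /\ x `&` a `&` \meet_(i <- l) i = \bot.
  move=> Fa; apply: contrapT => nl.
  apply: (Fmax (F `|` [set a])%classic).
    split; last by move=> H; apply: Fa; apply: H; right.
    by move=> b; left.
  move=> l lF; apply: contra_notN nl => /eqP xl0.
  exists [seq b <- l | `[< F b >]]; split.
    by move=> b; rewrite mem_filter => /andP[/asboolP].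
  apply/eqP; rewrite -lex0 -xl0 -meetA leI2//.
  elim: l {xl0} lF => [|b l IH] lF; first by rewrite !big_nil lex1.
  rewrite /= big_cons lexI.
  have lF' b' : b' \in l -> (F `|` [set a])%classic b'.
    by move=> bl; apply: lF; rewrite inE bl orbT.
  case: ifPn => [Fb|/asboolPn Fb].
    rewrite big_cons meetA (meetC a) -meetA leIl/=.
    by rewrite (le_trans _ (IH lF')) // leIr.
  rewrite (IH lF') andbT.
  have /lF[//|->] : b \in b :: l by rewrite mem_head.
  by rewrite leIl.
have FI l a : (forall b, b \in l -> F b) -> \meet_(i <- l) i <= a -> F a.
  move=> lF la; apply: contrapT => /notF[m [mF]] xam.
  have := Ffip (l ++ m); rewrite big_cat/=.
  have lm b : b \in l ++ m -> F b by rewrite mem_cat => /orP[/lF|/mF].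
  move=> /(_ lm) /negP; apply; rewrite -lex0 -xam -meetA leI2// leI2//.
exists (fun a => `[< F a >]).
  split=> [a b|a]; apply/idP/idP.
  - move=> /asboolP Fab; apply/andP; split; apply/asboolP;
    by apply: (FI [:: a `&` b]); rewrite ?big_seq1 ?leIl ?leIr// => c; rewrite inE => /eqP ->.
  - move=> /andP[/asboolP Fa /asboolP Fb]; apply/asboolP; apply: (FI [:: a; b]).
      by move=> c; rewrite !inE => /orP[] /eqP ->.
    by rewrite big_cons big_seq1.
  - move=> /asboolP Fca; apply/asboolPn => Fa.
    have := Ffip [:: a; ~` a]; rewrite big_cons big_seq1 meetxC meetx0 eqxx.
    have H c : c \in [:: a; ~` a] -> F c by rewrite !inE => /orP[] /eqP ->.
    by move=> /(_ H).
  - move=> /asboolPn/notF[l [lF l0]]; apply/asboolP; apply: contrapT => /notF[m [mF m0]].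
    have := Ffip (l ++ m); rewrite big_cat/=.
    have lm b : b \in l ++ m -> F b by rewrite mem_cat => /orP[/lF|/mF].
    move=> /(_ lm) /negP; apply.
    move: l0 m0; set L := \big[_/_]_(i <- l) i; set M := \big[_/_]_(i <- m) i => l0 m0.
    rewrite -[x]meetx1 -(joinxC a) meetUr meetUl -lex0 leUx.
    apply/andP; split.
      by rewrite -l0 leI2// leIl.
    by rewrite -m0 leI2// leIr.
apply/asboolP; apply: contrapT => /notF[l [lF]].
by rewrite meetxx => xl0; have /eqP := Ffip l lF.
Qed.

(** If x <= y fails, then x /\ ~y is non-zero and belongs to some ultrafilter. *)
Lemma ultra_leP x y : (forall u, ultra u -> u x ==> u y) -> x <= y.
Proof.
move=> h; rewrite -[y]complK -disj_leC; apply/negPn/negP => /exists_ultra[u hu].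
by rewrite ultraI// ultraC// => /andP[ux]; have := h u hu; rewrite ux => /= ->.
Qed.

Lemma ultra_eqP x y : (forall u, ultra u -> u x = u y) -> x = y.
Proof. by move=> h; apply/le_anti/andP; split; apply: ultra_leP => u /h ->; exact: implybb. Qed.

End Ultra.

(* Evaluation at an arbitrary ultrafilter reduces a Boolean (in)equality to a
   truth table, with the (in)equalities of the context as hypotheses. *)
Ltac ba_hyps u hu := repeat match goal with
  | H : is_true (_ <= _) |- _ => move: (ultra_le hu H); clear H
  | H : _ = _ |- _ => move: (congr1 u H); clear H
  end.
Ltac ba_cases u := repeat match goal with
  | |- context [u ?x] => case: (u x) => //=
  end.
Ltac ba :=
  lazymatch goal with
  | |- is_true (_ == _) => apply/eqP; apply: ultra_eqP
  | |- is_true _ => apply: ultra_leP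
  | _ => apply: ultra_eqP
  end;
  intros;
  lazymatch goal with hu : ultra ?u |- _ =>
    ba_hyps u hu;
    rewrite ?(ultraI hu, ultraU hu, ultraC hu, ultra0 hu, ultra1 hu, ultra_meets hu, ultra_joins hu) /=;
    ba_cases u
  end.

(** * Subalgebras and completions *)

Record subalgebra d (A : ctbDistrLatticeType d) := Subalgebra {
  carrier :> A -> Prop;
  carrier0 : carrier \bot;
  carrierI : forall x y, carrier x -> carrier y -> carrier (x `&` y);
  carrierC : forall x, carrier x -> carrier (~` x) }.

(** Membership is reflected into [bool], so that two elements with the same [val] are equal. *)
Definition subalg d (A : ctbDistrLatticeType d) (S : subalgebra A) :=
  {a : A | `[< S a >]}.

Section SubAlgebra.
Context d (A : ctbDistrLatticeType d) (S : subalgebra A).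
Local Notation T := (subalg S).

HB.instance Definition _ := Choice.on T.

Lemma subP (a : T) : S (val a). Proof. exact/asboolP/(valP a). Qed.

Definition sub_mk a (h : S a) : T := exist _ a (asboolT h).

Lemma carrierU x y : S x -> S y -> S (x `|` y).
Proof. by move=> Sx Sy; rewrite -[_ `|` _]complK complU; do ?[apply: carrierC|apply: carrierI]. Qed.

Definition sub_meet (a b : T) := sub_mk (carrierI (subP a) (subP b)).
Definition sub_join (a b : T) := sub_mk (carrierU (subP a) (subP b)).
Definition sub_compl (a : T) := sub_mk (carrierC (subP a)).
Definition sub_bot := sub_mk (carrier0 S).
Definition sub_top := sub_compl sub_bot.
Definition sub_le (a b : T) := val a <= val b.
Definition sub_lt (a b : T) := (b != a) && sub_le a b.

Program Definition sub_distr := @Order.isMeetJoinDistrLattice.Build d T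
  sub_le sub_lt sub_meet sub_join _ _ _ _ _ _ _ _ _ _.
Next Obligation. by move=> x y; rewrite /sub_le leEmeet -val_eqE. Qed.
Next Obligation. by []. Qed.
Next Obligation. by move=> a b; apply: val_inj; rewrite /= meetC. Qed.
Next Obligation. by move=> a b; apply: val_inj; rewrite /= joinC. Qed.
Next Obligation. by move=> a b c; apply: val_inj; rewrite /= meetA. Qed.
Next Obligation. by move=> a b c; apply: val_inj; rewrite /= joinA. Qed.
Next Obligation. by move=> a b; apply: val_inj => /=; ba. Qed.
Next Obligation. by move=> a b; apply: val_inj => /=; ba. Qed.
Next Obligation. by move=> a b c; apply: val_inj => /=; ba. Qed.
Next Obligation. by move=> a; apply: val_inj; rewrite /= meetxx. Qed.
HB.instance Definition _ := sub_distr.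

Lemma sub_le0 (a : T) : sub_bot <= a. Proof. exact: le0x. Qed.
Lemma sub_le1 (a : T) : a <= sub_top.
Proof. by rewrite /(_ <= _) /= /sub_le /= compl0 lex1. Qed.
HB.instance Definition _ := Order.hasBottom.Build d T sub_le0.
HB.instance Definition _ := Order.hasTop.Build d T sub_le1.

Lemma sub_joinxC (a : T) : a `|` sub_compl a = \top.
Proof. by apply: val_inj => /=; ba. Qed.
Lemma sub_meetxC (a : T) : a `&` sub_compl a = \bot.
Proof. by apply: val_inj => /=; ba. Qed.
HB.instance Definition _ := Order.TBDistrLattice_hasComplement.Build d T
  sub_joinxC sub_meetxC.

Lemma val_hom : homomorphism (val : T -> A).
Proof. by split=> //=; rewrite compl0. Qed.

End SubAlgebra.

(** * The completion by annihilator ideals *)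

Section Completion.
Context d (A : ctbDistrLatticeType d).

Definition perp (S : set A) : set A := fun a => forall b, S b -> a `&` b = \bot.

(** The sets equal to their double polar are the annihilator ideals; in a Boolean algebra these are
    the cuts of the Dedekind-MacNeille completion. *)
Definition completion := {S : set A | `[< perp (perp S) = S >]}.
Local Notation T := completion.
HB.instance Definition _ := Choice.on T.

Lemma perp_anti (S R : set A) : (S `<=` R)%classic -> (perp R `<=` perp S)%classic.
Proof. by move=> SR a Ra b /SR/Ra. Qed.

Lemma perpPS (S : set A) : (S `<=` perp (perp S))%classic.
Proof. by move=> a Sa b /(_ _ Sa); rewrite meetC. Qed.

Lemma perp3 S : perp (perp (perp S)) = perp S.
Proof. by apply/seteqP; split; [apply/perp_anti/perpPS|apply: perpPS]. Qed.

Lemma regP (a : T) : perp (perp (val a)) = val a.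
Proof. exact/asboolP/(valP a). Qed.

Definition reg_mk S (h : perp (perp S) = S) : T := exist _ S (asboolT h).

Lemma regI (S R : set A) : perp (perp S) = S -> perp (perp R) = R ->
  perp (perp (S `&` R)%classic) = (S `&` R)%classic.
Proof.
move=> hS hR; apply/seteqP; split; last exact: perpPS.
move=> a h; split; [rewrite -hS|rewrite -hR]; move: a h; apply/perp_anti/perp_anti.
- exact: subIsetl.
- exact: subIsetr.
Qed.

Lemma reg0 : perp (perp [set \bot]%classic) = [set \bot]%classic.
Proof.
apply/seteqP; split; last exact: perpPS.
by move=> a /(_ \top) h; rewrite /= -[a]meetx1 h// => b ->; rewrite meetx0.
Qed.

Definition reg_meet (a b : T) := reg_mk (regI (regP a) (regP b)).
Definition reg_compl (a : T) := reg_mk (perp3 (val a)).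
Definition reg_join (a b : T) := reg_compl (reg_meet (reg_compl a) (reg_compl b)).
Definition reg_bot : T := reg_mk reg0.
Definition reg_top := reg_compl reg_bot.
Definition reg_le (a b : T) := reg_meet a b == a.
Definition reg_lt (a b : T) := (b != a) && reg_le a b.

Lemma reg_down (a : T) x y : x <= y -> val a y -> val a x.
Proof.
by move=> xy; rewrite -(regP a) => ay b /ay yb; ba.
Qed.

(** Otherwise some [b] polar to [a] meets [x], and a non-zero member of [a] below x /\ b would be
    disjoint from itself. *)
Lemma reg_in (a : T) x : (forall y, y <= x -> y != \bot -> exists z, [/\ z <= y, z != \bot & val a z]) -> val a x.
Proof.
move=> h; rewrite -(regP a) => b hb; apply: contrapT => /eqP xb0.
have [z [zxb z0 az]] := h (x `&` b) (leIl _ _) xb0.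
have := hb _ az; move/eqP: z0 => z0 bz; apply: z0; ba.
Qed.

(** A join is the double polar of a union, so membership in it is a density condition; this reduces
    the lattice laws to pointwise arguments. *)
Lemma reg_joinP (a b : T) x : val (reg_join a b) x <->
  (forall y, y <= x -> y != \bot -> exists z, [/\ z <= y, z != \bot & val a z \/ val b z]).
Proof.
split=> [h y yx y0|h].
  apply: contrapT => nz.
  have yc c : val a c \/ val b c -> y `&` c = \bot.
    move=> abc; apply: contrapT => /eqP yc; apply: nz; exists (y `&` c).
    rewrite leIl; split=> //.
    by case: abc => hc; [left|right]; apply: reg_down hc; rewrite leIr.
  have y1 : (perp (val a) `&` perp (val b))%classic y.
    by split=> c hc; apply: yc; [left|right].
  have := h _ y1; move/eqP: y0 => y0 xy; apply: y0; ba.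
move=> c [ca cb]; apply: contrapT => /eqP xc0.
have [z [zxc z0 [|] hz]] := h (x `&` c) (leIl _ _) xc0.
  have := ca _ hz; move/eqP: z0 => z0 bz; apply: z0; ba.
have := cb _ hz; move/eqP: z0 => z0 bz; apply: z0; ba.
Qed.

Lemma reg_eq (a b : T) : (forall x, val a x <-> val b x) -> a = b.
Proof. by move=> h; apply/val_inj/seteqP; split=> x /h. Qed.

Lemma reg_joinC : commutative reg_join.
Proof. by move=> a b; apply: reg_eq => x; rewrite /reg_join /= setIC. Qed.

Lemma reg_join_l (a b : T) x : val a x -> val (reg_join a b) x.
Proof.
move=> ax; apply/reg_joinP => y yx y0; exists y; split => //; left.
exact: reg_down ax.
Qed.

Program Definition reg_distr := @Order.isMeetJoinDistrLattice.Build d T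
  reg_le reg_lt reg_meet reg_join _ _ _ reg_joinC _ _ _ _ _ _.
Next Obligation. by []. Qed.
Next Obligation. by []. Qed.
Next Obligation. by move=> a b; apply: val_inj; rewrite /= setIC. Qed.
Next Obligation. by move=> a b c; apply: val_inj; rewrite /= setIA. Qed.
Next Obligation.
by move=> a b c; apply: val_inj; rewrite /= !regI ?perp3// setIA.
Qed.
Next Obligation.
by move=> b a; apply: reg_eq => z; split=> [[]//|az]; split=> //; exact: reg_join_l.
Qed.
Next Obligation.
move=> b a; apply: reg_eq => z; split=> [/reg_joinP h|az]; last exact: reg_join_l.
by apply: reg_in => w wz /(h _ wz)[v [vw v0 [|[]]]]; exists v.
Qed.
Next Obligation.
move=> a b c; apply: reg_eq => x; split=> [[/reg_joinP h cx]|/reg_joinP h].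
  apply/reg_joinP => y yx /(h _ yx)[z [zy z0 abz]]; exists z; split => //.
  have cz : val c z by apply: reg_down cx; exact: le_trans yx.
  by case: abz; [left|right].
split; first by apply/reg_joinP => y yx /(h _ yx)[z [zy z0 [[]|[]]]]; exists z; split=> //; [left|right].
by apply: reg_in => y yx /(h _ yx)[z [zy z0 [[]|[]]]]; exists z; split.
Qed.
Next Obligation. by move=> a; apply: val_inj; rewrite /= setIid. Qed.
HB.instance Definition _ := reg_distr.

Lemma reg_leP (a b : T) : reflect (val a `<=` val b)%classic (a <= b).
Proof.
apply: (iffP eqP) => [<- x []//|ab]; apply: reg_eq => x; split=> [[]//|ax].
by split=> //; exact: ab.
Qed.

Lemma reg_le0 (a : T) : reg_bot <= a.
Proof. by apply/reg_leP => _ ->; rewrite -(regP a) => b _; rewrite meet0x. Qed.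
Lemma reg_le1 (a : T) : a <= reg_top.
Proof. by apply/reg_leP => x _ _ ->; rewrite meetx0. Qed.
HB.instance Definition _ := Order.hasBottom.Build d T reg_le0.
HB.instance Definition _ := Order.hasTop.Build d T reg_le1.

Lemma reg_meetxC (a : T) : a `&` reg_compl a = \bot.
Proof.
apply/le_anti; rewrite le0x andbT; apply/reg_leP => x [ax] /(_ _ ax).
by rewrite meetxx.
Qed.
Lemma reg_joinxC (a : T) : a `|` reg_compl a = \top.
Proof.
apply: reg_eq => x; split=> [_ _ ->|_]; first by rewrite meetx0.
by move=> b [h1 h2]; have := h2 _ h1; rewrite meetxx => ->; rewrite meetx0.
Qed.
HB.instance Definition _ := Order.TBDistrLattice_hasComplement.Build d T
  reg_joinxC reg_meetxC.

Lemma completion_complete : complete completion.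
Proof.
move=> F.
have lub : exists s : T, supremums F s.
  exists (reg_mk (perp3 (perp (\bigcup_(a in F) val a)%classic))); split.
    by move=> a Fa; apply/reg_leP => x ax; apply: perpPS; exists a.
  move=> b ub; apply/reg_leP; rewrite -(regP b); apply/perp_anti/perp_anti.
  by move=> x [a /ub/reg_leP]; apply.
split=> //.
exists (reg_mk (perp3 (\bigcup_(a in F) perp (val a))%classic)); split.
  move=> a Fa; apply/reg_leP; rewrite -(regP a); apply: perp_anti => x ax.
  by exists a.
move=> b lb; apply/reg_leP => x bx y [a /lb/reg_leP /(_ _ bx) ax] /(_ _ ax).
by rewrite meetC.
Qed.

Lemma below_reg (a : A) : perp (perp [set x | x <= a]%classic) = [set x | x <= a]%classic.
Proof.
apply/seteqP; split; last exact: perpPS.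
move=> x /(_ (~` a)) h; rewrite /= -[a]complK -disj_leC; apply/eqP/h.
by move=> b /= ba; ba.
Qed.

Definition below (a : A) : completion := reg_mk (below_reg a).

Lemma below_hom : homomorphism below.
Proof.
have hC : {morph below : x / ~` x}.
  move=> x; apply: reg_eq => z; split=> [/= zx b /= bx|/(_ x (lexx x)) zx]; first by ba.
  by rewrite /= -disj_leC zx.
have hI : {morph below : x y / x `&` y}.
  by move=> x y; apply: reg_eq => z /=; rewrite lexI; split=> [/andP//|[-> ->]].
have h0 : below \bot = \bot by apply: reg_eq => z /=; rewrite lex0; split=> [/eqP|->].
split=> //.
  by move=> x y; rewrite -[x `|` y]complK complU hC hI !hC complI !complK.
by rewrite -compl0 hC h0 compl0.
Qed.

Lemma below_inj : injective below.
Proof.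
move=> a b ab; have H x : (x <= a : Prop) = (x <= b) := congr1 (fun S => val S x) ab.
by apply/le_anti/andP; split; [rewrite -(H a)|rewrite (H b)].
Qed.

Lemma below_dense (c : completion) : c != \bot -> exists2 a, a != \bot & below a <= c.
Proof.
move=> c0; apply: contrapT => h; move/eqP: c0; apply; apply/le_anti; rewrite le0x andbT.
apply/reg_leP => x cx; apply: contrapT => /eqP x0; apply: h; exists x => //.
by apply/reg_leP => y yx; exact: reg_down cx.
Qed.

End Completion.

(** * Countable closures and bounded antichains *)

(** The closure of [i0] under the rules [F] is enumerated by finite trees: a leaf denotes [i0], and
    a node labelled by a code of (n, k) denotes the entry [k] of [F l n], where [l] lists the values
    of its subtrees. The last clause is induction over the closure. *)
Lemma countable_closure (I : eqType) (i0 : I) (F : seq I -> nat -> seq I) :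
  exists z : nat -> I,
    [/\ range z i0,
        forall l n j, (forall i, i \in l -> range z i) -> j \in F l n -> range z j &
        forall Q : I -> Prop, Q i0 ->
          (forall l n j, (forall i, i \in l -> Q i) -> j \in F l n -> Q j) ->
          forall n, Q (z n)].
Proof.
pose Th l m := let: (n, k) := odflt (0%N, 0%N) (choice.unpickle m) in nth i0 (F l n) k.
pose fix ev (t : GenTree.tree unit) : I :=
  match t with GenTree.Leaf _ => i0 | GenTree.Node n ts => Th (map ev ts) n end.
pose tr (n : nat) : GenTree.tree unit := odflt (GenTree.Leaf tt) (choice.unpickle n).
have trK t : tr (choice.pickle t) = t by rewrite /tr choice.pickleK.
have evK t : (ev \o tr) (choice.pickle t) = ev t := congr1 ev (trK t).
exists (ev \o tr); split.
- by exists (choice.pickle (GenTree.Leaf tt)) => //; exact: evK.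
- move=> l n j lz jF.
  have [l' lE] : exists l', l = map (ev \o tr) l'.
    elim: l lz {jF} => [|i l IH] lz; first by exists [::].
    have [m _ <-] := lz i (mem_head _ _).
    have [|l' ->] := IH; last by exists (m :: l').
    by move=> k kl; apply: lz; rewrite inE kl orbT.
  pose m := choice.pickle (n, index j (F l n)).
  exists (choice.pickle (GenTree.Node m (map tr l'))) => //.
  by rewrite evK /= -map_comp -lE /Th /m choice.pickleK /= nth_index.
move=> Q Q0 QF n; rewrite /=; move: (tr n) => {n}; fix IH 1 => -[x|m ts] //=.
rewrite /Th; case: (odflt _ _) => n k.
(* An index beyond the list yields [i0], which [Q0] covers. *)
have [kF|Fk] := ltnP k (size (F (map ev ts) n)); last by rewrite nth_default.
apply: QF (mem_nth _ kF); elim: ts {kF} => [|t ts IHt] i //=; rewrite inE => /orP[/eqP ->|/IHt//].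
exact: IH.
Qed.

(** * Families with pairwise conflicting finite supports *)

Section Conflict.
Context (T : Type) (K : eqType) (hold : T -> K -> bool).

(** Read [x] as the finite partial function with domain [s x] and values [hold x]: a conflict is an
    incompatibility of two such functions. *)
Definition conflict (s : T -> seq K) (x y : T) :=
  has (fun c => (c \in s y) && (hold x c != hold y c)) (s x).

Lemma count_has (p : T -> K -> bool) (cs : seq K) (l : seq T) :
  (count (fun y => has (p y) cs) l <= \sum_(c <- cs) count (p^~ c) l)%N.
Proof.
elim: cs => [|c cs IH]; first by rewrite big_nil (eq_count (a2 := pred0)) // count_pred0.
rewrite big_cons (leq_trans _ (leq_add (leqnn _) IH))//.
by rewrite -count_predUI leq_addr.
Qed.

(* Sort the members of the family that conflict with its first member [x] by
   the place [c] of the conflict; two members with the same [c] agree at [c],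
   so [c] can be dropped from all the supports. *)
Lemma conflict_bound k : exists N, forall (s : T -> seq K) (l : seq T),
  all (fun x => size (s x) <= k)%N l -> pairwise (conflict s) l -> (size l <= N)%N.
Proof.
elim: k => [|k [N HN]].
  exists 1%N => s [//|x [//|y l]] /= /andP[+ _] /andP[/andP[+ _] _].
  by rewrite leqn0 size_eq0 /conflict => /eqP ->.
exists (k.+1 * N).+1 => s [//|x l] /= /andP[sx sl] /andP[xl ll].
rewrite ltnS.
pose p y c := (c \in s y) && (hold x c != hold y c).
have /eqP <- : count (fun y => has (p y) (s x)) l == size l by rewrite -all_count.
apply: leq_trans (count_has _ _ _) _.
apply: leq_trans (leq_mul sx (leqnn N)).
rewrite -[X in (_ <= X * _)%N]/(size (s x)) -sum1_size big_distrl /= leq_sum // => c _.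
rewrite mul1n -size_filter.
pose s' y := [seq c' <- s y | c' != c].
apply: (HN s').
  rewrite all_filter; apply: sub_all sl => y sy; apply/implyP => /andP[cy _].
  rewrite -ltnS (leq_trans _ sy)// size_filter -(count_predC (pred1 c)) addnC.
  by rewrite -addn1 leq_add2l -has_count has_pred1.
apply: (@sub_in_pairwise _ (p^~ c) (conflict s)); last first.
- exact: pairwise_filter.
- by rewrite filter_all.
move=> y y' /andP[_ hy] /andP[_ hy'] /hasP[c' c'y /andP[c'y' hc']].
apply/hasP; exists c'; last first.
  rewrite mem_filter c'y' hc' !andbT; apply: contraNneq hc' => ->.
  by move: hy hy'; case: (hold x c); case: (hold y c); case: (hold y' c).
rewrite mem_filter c'y andbT; apply: contraNneq hc' => ->.
by move: hy hy'; case: (hold x c); case: (hold y c); case: (hold y' c).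
Qed.
End Conflict.

(** * Projections and supports *)

Section Sup.
Context d (B : ctbDistrLatticeType d).
Implicit Types (D : set B) (b c p : B).

(* Each such [b] is the supremum of the elements of [D] below it. *)
Definition sups D : set B := fun b => forall c, c != \bot -> c <= b ->
  exists p, [/\ D p, p <= b & p `&` c != \bot].

(** The sigma-bounded chain condition: [h] distributes [D] over countably many classes, and within
    each class antichains have bounded length. *)
Definition bounded_antichains D (h : nat -> set B) : Prop :=
  (forall b, D b -> exists k, h k b) /\
  (forall k, exists N, forall L : seq B,
    (forall b, b \in L -> D b /\ h k b) ->
    pairwise (fun x y => x `&` y == \bot) L -> (size L <= N)%N).

Lemma sups_mono D D' : (D `<=` D')%classic -> (sups D `<=` sups D')%classic.
Proof. by move=> DD b h c c0 /(h _ c0)[p [/DD]]; exists p. Qed.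

Lemma sups_in D b : D b -> sups D b.
Proof. by move=> Db c c0 cb; exists b; split=> //; rewrite (meet_idPr cb). Qed.

Lemma sups0 D : sups D \bot.
Proof. by move=> c c0; rewrite lex0 (negbTE c0). Qed.

Lemma sups_below D b : sups D b -> b != \bot -> exists p, [/\ D p, p != \bot & p <= b].
Proof.
move=> h b0; have [p [Dp pb pb0]] := h b b0 (lexx _); exists p; split=> //.
by apply: contra_neq pb0 => ->; rewrite meet0x.
Qed.

Lemma supsI D b c : nonzero_meet_closed D -> sups D b -> sups D c -> sups D (b `&` c).
Proof.
move=> DI hb hc e e0 ebc.
have eb : e <= b by ba.
have [p [Dp pb pe]] := hb _ e0 eb.
have ec : p `&` e <= c by ba.
have [q [Dq qc qe]] := hc _ pe ec.
exists (p `&` q); split; last by apply: contra_neq qe => h; ba.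
  by apply: DI => //; apply: contra_neq qe => h; ba.
by ba.
Qed.

Lemma supsU D b c : sups D b -> sups D c -> sups D (b `|` c).
Proof.
move=> hb hc e e0 ebc; case: (eqVneq (e `&` b) \bot) => eb.
  have ec : e <= c by ba.
  have [p [Dp pc pe]] := hc _ e0 ec; exists p; split=> //; ba.
have [|p [Dp pb pe]] := hb _ eb; first by rewrite leIr.
exists p; split=> //; first by ba.
by apply: contra_neq pe => h; ba.
Qed.

Lemma sups_joins D (l : seq B) : (forall b, b \in l -> sups D b) ->
  sups D (\join_(b <- l) b).
Proof.
elim: l => [|b l IH] hl; first by rewrite big_nil; exact: sups0.
rewrite big_cons; apply: supsU; first by apply: hl; rewrite mem_head.
by apply: IH => c cl; apply: hl; rewrite inE cl orbT.
Qed.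

End Sup.

(** * Finite meets of generators and rich algebras *)

Section Generated.
Context d (B : ctbDistrLatticeType d) (I : eqType) (g : I -> B).
Implicit Types (S T : set I) (b c p t w : B).

Definition fin_meets S : set B := fun b => b != \bot /\
  exists2 l : seq I, (forall i, i \in l -> S i) & b = \meet_(i <- l) g i.

Lemma fin_meets_meet S : nonzero_meet_closed (fin_meets S).
Proof.
move=> a b [a0 [l lS ->]] [b0 [m mS ->]] ab0; split=> //.
by exists (l ++ m); rewrite ?big_cat// => i; rewrite mem_cat => /orP[/lS|/mS].
Qed.

Lemma fin_meets_mono S T : (S `<=` T)%classic -> (fin_meets S `<=` fin_meets T)%classic.
Proof. by move=> ST b [b0 [l lS bE]]; split=> //; exists l => // i /lS/ST. Qed.

Lemma fin_meets1 S : nondegenerate B -> fin_meets S \top.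
Proof. by move=> h; split; [rewrite eq_sym; exact: h|exists [::]; rewrite ?big_nil]. Qed.

Lemma fin_meets_gen S i : S i -> g i != \bot -> fin_meets S (g i).
Proof.
by move=> Si gi; split=> //; exists [:: i]; rewrite ?big_seq1// => j; rewrite inE => /eqP ->.
Qed.

Lemma fin_meetsU S T b : fin_meets (S `|` T)%classic b ->
  exists p t, [/\ fin_meets S p, fin_meets T t & b = p `&` t].
Proof.
case=> b0 [l lST bE].
exists (\meet_(i <- l | `[< S i >]) g i), (\meet_(i <- l | ~~ `[< S i >]) g i).
have E : b = \meet_(i <- l | `[< S i >]) g i `&` \meet_(i <- l | ~~ `[< S i >]) g i.
  by rewrite bE (bigID (fun i => `[< S i >])).
split=> //; split.
- by apply: contra_neq b0 => h; rewrite E h meet0x.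
- exists [seq i <- l | `[< S i >]]; last by rewrite big_filter.
  by move=> i; rewrite mem_filter => /andP[/asboolP].
- by apply: contra_neq b0 => h; rewrite E h meetx0.
- exists [seq i <- l | ~~ `[< S i >]]; last by rewrite big_filter.
  by move=> i; rewrite mem_filter => /andP[/asboolPn nS /lST[]].
Qed.

Lemma fin_meets_chain (F : set (set I)) b : (exists S, F S) -> total_on F subset ->
  fin_meets (\bigcup_(S in F) S)%classic b -> exists2 S, F S & fin_meets S b.
Proof.
move=> [S0 FS0] Ftot [b0 [l lF bE]].
suff [S FS lS] : exists2 S, F S & forall i, i \in l -> S i.
  by exists S => //; split=> //; exists l.
elim: l lF {bE} => [|i l IH] lF; first by exists S0.
have [S FS lS] := IH (fun j jl => lF j (mem_behead (s := i :: l) jl)).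
have [T FT iT] := lF i (mem_head _ _).
have [ST|TS] := Ftot _ _ FS FT.
  by exists T => // j; rewrite inE => /orP[/eqP->|/lS/ST].
by exists S => // j; rewrite inE => /orP[/eqP->|/lS]; first exact: TS.
Qed.

Section Support.
Context (h : nat -> set B).
Hypothesis dense : forall b, b != \bot -> exists2 p, fin_meets setT p & p <= b.
Hypothesis bdd : bounded_antichains (fin_meets setT) h.

(* For each [k], take a longest antichain of elements of class [k] below [b]:
   the supremum of the union of these antichains is [b]. *)
Lemma countable_support b : exists z : nat -> seq I, forall T : set I,
  (forall n i, i \in z n -> T i) -> sups (fin_meets T) b.
Proof.
pose ok k (L : seq (seq I)) := pairwise (fun x y => x `&` y == \bot) [seq \meet_(i <- l) g i | l <- L]
  /\ forall l, l \in L -> [/\ fin_meets setT (\meet_(i <- l) g i), h k (\meet_(i <- l) g i) & \meet_(i <- l) g i <= b].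
have [L HL] : exists L : nat -> seq (seq I), forall k,
    ok k (L k) /\ forall L', ok k L' -> (size L' <= size (L k))%N.
  suff /choice[L HL] : forall k, exists L, ok k L /\ forall L', ok k L' -> (size L' <= size L)%N by exists L.
  move=> k.
  have [N HN] := bdd.2 k.
  pose P n := `[< exists L, ok k L /\ size L = n >].
  have exP : exists n, P n by exists 0%N; apply/asboolP; exists [::].
  have ubP n : P n -> (n <= N)%N.
    move=> /asboolP[L [[pL okL] <-]].
    rewrite -(size_map (fun l => \meet_(i <- l) g i)); apply: HN => //.
    by move=> _ /mapP[l /okL[? ? _] ->].
  case: (ex_maxnP exP ubP) => n /asboolP[L [okL sL]] maxn.
  by exists L; split=> // L' okL'; rewrite sL; apply: maxn; apply/asboolP; exists L'.
pose z (n : nat) := let: (k, j) := odflt (0%N, 0%N) (choice.unpickle n) in nth [::] (L k) j.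
have zL k l : l \in L k -> exists n, z n = l.
  move=> lL; exists (choice.pickle (k, index l (L k))).
  by rewrite /z choice.pickleK /= nth_index.
exists z => T zT c c0 cb; apply: contrapT => nT.
have [p0 [p00 [l0 _ p0E]] p0c] := dense c0.
have Dp0 : fin_meets setT p0 by split=> //; exists l0.
have [k hk] := bdd.1 _ Dp0.
have [[pL okL] maxL] := HL k.
(* If no finite meet over [T] below [b] met [c], then [p0] would be disjoint from all of [L k] and
   prolong this longest antichain. *)
have : ok k (l0 :: L k).
  split=> /=.
    rewrite pL andbT; apply/allP => _ /mapP[l lL ->]; rewrite -p0E.
    have [[l0' _] _ lb] := okL _ lL.
    have [n zn] := zL _ _ lL.
    case: (eqVneq (\meet_(i <- l) g i `&` c) \bot) => [e|e]; first by move: (\meet_(i <- l) g i) e {l0' lb} => m e; ba.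
    case: nT; exists (\meet_(i <- l) g i); split=> //; split=> //.
    by exists l => // i; rewrite -zn; exact: zT.
  move=> l; rewrite inE => /orP[/eqP ->|/okL//]; rewrite -p0E; split=> //.
  exact: le_trans cb.
by move=> /maxL /=; rewrite ltnn.
Qed.

End Support.

(* [ph i n] runs through the countably many indices that must accompany [i]. *)
Variable ph : I -> nat -> seq I.

Definition index_closed S : Prop := forall i n j, S i -> j \in ph i n -> S j.

(* In [rich_proj], [w] is the upper projection of [t] to the algebra generated
   by [S]; projecting does not leave the algebra generated by [T]. *)
Record rich (h : nat -> set B) : Prop := Rich {
  rich_dense : forall b, b != \bot -> exists2 p, fin_meets setT p & p <= b;
  rich_bdd : bounded_antichains (fin_meets setT) h;
  rich_proj : forall S T t, index_closed S -> index_closed T -> fin_meets T t ->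
    exists w, [/\ sups (fin_meets S) w, sups (fin_meets T) w, t <= w &
      forall p, fin_meets S p -> p `&` t = \bot -> p `&` w = \bot] }.

Context h (hrich : rich h).

Lemma index_closedT : index_closed setT. Proof. by []. Qed.

Lemma index_closedU S T : index_closed S -> index_closed T -> index_closed (S `|` T)%classic.
Proof. by move=> cS cT i n j [Si|Ti] ij; [left; apply: cS ij|right; apply: cT ij]. Qed.

(** A non-zero [c] disjoint from [b] contains some finite meet [p], whose projection [w] to [S] is
    still disjoint from [b]; a finite meet over [S] that lies below [w] and meets [c] is then below
    the complement of [b]. *)
Lemma sups_compl S b : index_closed S -> sups (fin_meets S) b -> sups (fin_meets S) (~` b).
Proof.
move=> cS hb c c0 cb; have [p Dp pc] := rich_dense hrich c0.
have [w [Sw _ pw hw]] := rich_proj hrich cS index_closedT Dp.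
have p0 := Dp.1.
have wb : w `&` b = \bot.
  apply: contrapT => /eqP wb0; have [|q [Dq qb qw]] := hb _ wb0; first exact: leIr.
  have qp : q `&` p = \bot by ba.
  by have qw0 := hw _ Dq qp; case/eqP: qw; ba.
have wp0 : w `&` c != \bot by apply: contra_neq p0 => e; ba.
have [|q [Dq qw qc]] := Sw _ wp0; first exact: leIl.
exists q; split=> //; first by ba.
by apply: contra_neq qc => e; ba.
Qed.

(** Closure under complements turns the disjointness clause of [rich_proj] into minimality among all
    upper bounds of [t] in the completion of the algebra generated by [S]. *)
Lemma projection_exists S T t : index_closed S -> index_closed T -> fin_meets T t ->
  exists w, [/\ sups (fin_meets S) w, sups (fin_meets T) w, t <= w &
    forall e, sups (fin_meets S) e -> t <= e -> w <= e].
Proof.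
move=> cS cT Dt; have [w [Sw Tw tw hw]] := rich_proj hrich cS cT Dt.
exists w; split=> // e /(sups_compl cS) he te.
apply: contrapT => we; have e0 : w `&` ~` e != \bot by apply/eqP => e0; apply: we; ba.
have [|p [Dp pe pw]] := he _ e0; first exact: leIr.
have pt : p `&` t = \bot by ba.
by have pw0 := hw _ Dp pt; case/eqP: pw; ba.
Qed.

End Generated.

(** * Construction of a coherent base *)

Section FiniteJoins.
Context d (A : ctbDistrLatticeType d).
Implicit Types (X : set A) (a b c : A).

Definition finite_joins X : set A := fun a =>
  exists2 l : seq A, (forall x, x \in l -> X x) & a = \join_(x <- l) x.

Lemma finite_joins0 X : finite_joins X \bot.
Proof. by exists [::]; rewrite ?big_nil. Qed.

Lemma finite_joins_in X a : X a -> finite_joins X a.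
Proof. by move=> Xa; exists [:: a]; rewrite ?big_seq1// => x; rewrite inE => /eqP ->. Qed.

Lemma finite_joinsU X a b : finite_joins X a -> finite_joins X b -> finite_joins X (a `|` b).
Proof.
move=> [l lX ->] [m mX ->]; exists (l ++ m); last by rewrite big_cat.
by move=> x; rewrite mem_cat => /orP[/lX|/mX].
Qed.

Lemma finite_joins_ind X (P : A -> Prop) : P \bot ->
  (forall a b, X a -> P b -> P (a `|` b)) -> forall a, finite_joins X a -> P a.
Proof.
move=> P0 PU _ [l lX ->]; elim: l lX => [|x l IH] lX; first by rewrite big_nil.
rewrite big_cons; apply: PU; first by apply: lX; rewrite mem_head.
by apply: IH => y yl; apply: lX; rewrite inE yl orbT.
Qed.

Lemma finite_joins_mono X (Y : set A) a : (X `<=` finite_joins Y)%classic ->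
  finite_joins X a -> finite_joins Y a.
Proof.
move=> XY; move: a; apply: finite_joins_ind; first exact: finite_joins0.
by move=> a b /XY; exact: finite_joinsU.
Qed.

Lemma finite_joinsI X a b : nonzero_meet_closed X ->
  finite_joins X a -> finite_joins X b -> finite_joins X (a `&` b).
Proof.
move=> XI Ja Jb; move: a Ja; apply: finite_joins_ind => [|a c Xa Jc].
  by rewrite meet0x; exact: finite_joins0.
rewrite meetUl; apply: finite_joinsU => //; move: b Jb {Jc c}; apply: finite_joins_ind => [|b c Xb Jc].
  by rewrite meetx0; exact: finite_joins0.
rewrite meetUr; apply: finite_joinsU => //.
case: (eqVneq (a `&` b) \bot) => [->|ab]; first exact: finite_joins0.
by apply: finite_joins_in; apply: XI.
Qed.

Lemma finite_joinsC X a : X \top -> nonzero_meet_closed X ->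
  (forall x, X x -> finite_joins X (~` x)) ->
  finite_joins X a -> finite_joins X (~` a).
Proof.
move=> X1 XI XC; move: a; apply: finite_joins_ind => [|a b Xa Jb].
  by rewrite compl0; exact: finite_joins_in.
by rewrite complU; apply: finite_joinsI => //; exact: XC.
Qed.

End FiniteJoins.

Section NonzeroMeets.
Context d (A : ctbDistrLatticeType d).
Implicit Types (F G : {fset A}).

Lemma nonzero_meets_mono F G c : (F `<=` G)%fset -> nonzero_meets F c -> nonzero_meets G c.
Proof.
by move=> FG [c0 [K [K0 KF cE]]]; split=> //; exists K; split=> //; exact: fsubset_trans FG.
Qed.

Lemma nonzero_meets_in F c : c \in F -> c != \bot -> nonzero_meets F c.
Proof.
move=> cF c0; split=> //; exists [fset c]%fset; split.
- by apply/fset0Pn; exists c; rewrite inE.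
- by rewrite fsub1set.
- by rewrite big_seq_fset1.
Qed.

End NonzeroMeets.

(** * Stages of the construction and their extension *)

Section Stage.
Context dB (B : ctbDistrLatticeType dB) (I : eqType) (g : I -> B).
Context (ph : I -> nat -> seq I) (h : nat -> set B) (hrich : rich g ph h).
Context dA (A : ctbDistrLatticeType dA) (io : A -> B).
Hypotheses (Bnd : nondegenerate B) (io_hom : homomorphism io) (io_inj : injective io).
Hypothesis io_dense : forall b, b != \bot -> exists2 a, a != \bot & io a <= b.
Implicit Types (S Sg : set I) (X : set A) (Q : {fset A}) (a q x y : A) (b e p : B).

(** For closed [S], these are the elements of [B] that belong to the completion of the algebra
    generated by [S]. *)
Local Notation E S := (sups (fin_meets g S)).

(* [X] is dense in the completion of the algebra generated by [Sg]. *)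
Record stage Sg X (s : A -> {fset A}) : Prop := Stage {
  stage_closed : index_closed ph Sg;
  stage_neq0 : forall x, X x -> x != \bot;
  stage_sups : forall x, X x -> E Sg (io x);
  stage1 : X \top;
  stageI : nonzero_meet_closed X;
  stageC : forall x, X x -> finite_joins X (~` x);
  stage_dense : forall p, fin_meets g Sg p -> exists2 x, X x & io x <= p;
  stage_top : forall x, X x -> \top \in s x;
  stage_sep : coherent_finite_separation X s }.

Let ioI : {morph io : x y / x `&` y}. Proof. by case: io_hom. Qed.
Let ioC : {morph io : x / ~` x}. Proof. by case: io_hom. Qed.
Let io0 : io \bot = \bot. Proof. by case: io_hom. Qed.
Let io1 : io \top = \top. Proof. by case: io_hom. Qed.

Lemma io_le a x : (io a <= io x) = (a <= x).
Proof. by rewrite !leEmeet -ioI (inj_eq io_inj). Qed.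

Lemma io_eq0 a : (io a == \bot) = (a == \bot).
Proof. by rewrite -io0 (inj_eq io_inj). Qed.

Section Extend.
Context Sg X s (hst : stage Sg X s).
Let cSg := stage_closed hst.

(* [d] is the least element above [y] of the completion of the algebra
   generated by [Sg]. *)
Definition shadow d y := y <= d /\ forall e, E Sg e -> io y <= e -> io d <= e.

Lemma shadow_refl x : shadow x x. Proof. by []. Qed.

Lemma shadow_uniq d d' y : E Sg (io d) -> E Sg (io d') -> shadow d y -> shadow d' y -> d = d'.
Proof.
move=> Ed Ed' [yd h1] [yd' h2]; apply/le_anti; rewrite -!io_le h1 ?h2 ?io_le//.
Qed.

Lemma shadow_neq0 d y : d != \bot -> shadow d y -> y != \bot.
Proof.
move=> d0 [_ yh]; apply: contra_neq d0 => y0; apply/eqP; rewrite -io_eq0 -lex0.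
by apply: yh; [exact: sups0|rewrite y0 io0].
Qed.

(** Residuation: y /\ x <= e amounts to y <= e \/ ~x, whose right side stays in [E Sg]. *)
Lemma shadow_meet d y x : E Sg (io x) -> shadow d y -> shadow (d `&` x) (y `&` x).
Proof.
move=> Ex [yd yh]; split; first by rewrite leI2.
move=> e Ee; rewrite !ioI => yxe.
have /yh h1 : E Sg (e `|` ~` io x) by apply: supsU => //; exact: (sups_compl hrich).
have /h1 h2 : io y <= e `|` ~` io x by ba.
by ba.
Qed.

(** * Refining finite partitions over a closed set of generators *)

Section Countable.
Variable S : set I.
Hypothesis cS : index_closed ph S.
(** [S] has to support enough elements of [A] to be dense below its finite meets, and enough members
    of [X] below the projections of these meets to [Sg]. The countable closure in [stage_extend]
    provides such an [S]. *)
Hypothesis S_A : forall p, fin_meets g S p -> exists a, [/\ a != \bot, io a <= p & E S (io a)].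
Hypothesis S_X : forall p, fin_meets g S p -> exists x, [/\ X x, E S (io x) &
  forall e, E Sg e -> p <= e -> io x <= e].

(** A finite partition of unity in [A], supported by [S], whose members have their shadows in
    [X]. *)
Definition splitting Q := [/\ forall q, q \in Q -> E S (io q) /\ exists2 d, X d & shadow d q,
  forall q q', q \in Q -> q' \in Q -> q != q' -> q `&` q' = \bot &
  forall a, a != \bot -> exists2 q, q \in Q & q `&` a != \bot].

Definition refines Q Q' := forall q', q' \in Q' -> exists2 q, q \in Q & q' <= q.

(** As [x] is below the shadow of [q], the product x /\ q has shadow [x] and is non-zero; such
    products below each [a] make the tree dense. *)
Definition hits Q a := exists q d x, [/\ q \in Q, shadow d q /\ X d, X x /\ E S (io x), x <= d & x `&` q <= a].

(** A node [q] meeting [a] is split into a part [u] below [a] and the rest, such that both have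
    shadows in [X]: that of [u] is [x] by construction, and the rest keeps the shadow [dq] because
    it contains [p2], whose projection [w2] covers [u]. *)
Lemma refine Q a : splitting Q -> a != \bot -> E S (io a) ->
  exists Q', [/\ splitting Q', refines Q Q' & hits Q' a].
Proof.
move=> [Qq Qdis Qcov] a0 Ea.
have ESI b b' : E S b -> E S b' -> E S (b `&` b') by apply: supsI; exact: fin_meets_meet.
have [q qQ qa0] := Qcov _ a0; have [Eq [dq Xdq dqq]] := Qq _ qQ.
have Eqa : E S (io (q `&` a)) by rewrite ioI; exact: ESI.
have [|p [Sp p0 pqa]] := sups_below Eqa; first by rewrite io_eq0.
have [w [Sgw Sw pw wmin]] := projection_exists hrich cSg cS Sp.
have pa : p <= io a by move: pqa; rewrite ioI => pqa; ba.
have pq : p <= io q by move: pqa; rewrite ioI => pqa; ba.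
have EC b : E S b -> E S (~` b) := sups_compl hrich cS (b := b).
(* If the part of [q] below [w] lies inside [p], then [Q] need not change: x <= w gives x /\ q <= p
   <= a. Otherwise there is room for [p2]. *)
case: (eqVneq (io q `&` w `&` ~` p) \bot) => [qwp|qwp].
  exists Q; split; [by []|by move=> q' q'Q; exists q'|].
  have [x [Xx Ex xh]] := S_X Sp; exists q, dq, x; split=> //.
    rewrite -io_le; apply: xh; first exact: (stage_sups hst).
    by apply: (le_trans pq); rewrite io_le; case: dqq.
  have xw : io x <= w by apply: xh.
  by rewrite -io_le ioI; ba.
have [|p2 [Sp2 p20 p2qwp]] := sups_below (D := fin_meets g S) _ qwp.
  by apply: (ESI) => [|]; [exact: (ESI)|exact/EC/sups_in].
have [w2 [Sgw2 Sw2 p2w2 w2min]] := projection_exists hrich cSg cS Sp2.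
have w2w : w2 <= w by apply: w2min => //; ba.
(* If [p] missed [w2], the complement of [w2] would bound [p], hence also its projection [w],
   although p2 <= w. *)
have p'0 : p `&` w2 != \bot.
  apply: contraNneq p20 => pw20.
  have pw2 : p <= ~` w2 by ba.
  have ww2 : w <= ~` w2 by apply: wmin => //; exact: (sups_compl hrich).
  by ba.
have [p3 [Sp3 p30 p3p']] : exists p3, [/\ fin_meets g S p3, p3 != \bot & p3 <= p `&` w2].
  by apply: sups_below => //; apply: ESI => //; exact: sups_in.
have [a' [a'0 a'p3 Ea']] := S_A Sp3.
have [|p4 [Sp4 p40 p4a']] := sups_below Ea'; first by rewrite io_eq0.
have [x [Xx Ex xh]] := S_X Sp4.
(* Since [x] lies below the projection of p4 <= a', cutting [a'] by [x] makes [x] the shadow of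
   [u]. *)
pose u := x `&` a'.
have Eu : E S (io u) by rewrite ioI; exact: ESI.
have EX := stage_sups hst.
have ua' : io u <= io a' by rewrite io_le leIr.
have uq : u <= q by rewrite -io_le; ba.
have shu : shadow x u.
  split; first exact: leIl.
  move=> e Ee; rewrite ioI => xa'.
  have h1 : E Sg (e `|` ~` io x) by apply: supsU => //; apply: (sups_compl hrich) => //; exact: EX.
  have h2 : p4 <= e `|` ~` io x by ba.
  by have := xh _ h1 h2 => h3; ba.
have xw2 : io x <= w2 by apply: xh => //; ba.
(* An upper bound of the rest in [E Sg] is above [p2], hence above [w2], [x] and [u], and so above
   all of [q]. *)
have shqu : shadow dq (q `&` ~` u).
  case: dqq => qdq dqmin; split; first by ba.
  move=> e Ee; rewrite ioI ioC => que; apply: dqmin => //.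
  have p2e : p2 <= e by ba.
  have w2e := w2min _ Ee p2e.
  have xu : io u <= io x by rewrite io_le leIl.
  by ba.
have u0 : u != \bot by apply: shadow_neq0 shu; exact: (stage_neq0 hst).
have qu0 : q `&` ~` u != \bot by apply: shadow_neq0 shqu; exact: (stage_neq0 hst).
pose r := q `&` ~` u.
exists (u |` (r |` (Q `\ q)))%fset; split.
- split.
  + move=> q'; rewrite !inE => /or3P[/eqP->|/eqP->|/andP[_ /Qq//]].
      by split=> //; exists x.
    by split; [rewrite ioI ioC; apply: ESI => //; exact: EC|exists dq].
  + have aux q' : q' != q -> q' \in Q -> q' `&` q = \bot by move=> q'q q'Q; apply: Qdis.
    move=> q1 q2; rewrite !inE => /or3P[/eqP->|/eqP->|/andP[q1q q1Q]] /or3P[/eqP->|/eqP->|/andP[q2q q2Q]]; rewrite ?eqxx// => q12; try (by ba).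
    * by have := aux _ q2q q2Q => e; ba.
    * by have := aux _ q2q q2Q => e; ba.
    * by have := aux _ q1q q1Q => e; ba.
    * by have := aux _ q1q q1Q => e; ba.
    * exact: Qdis.
  + move=> b b0; have [q' q'Q q'b] := Qcov _ b0.
    case: (eqVneq q' q) => [q'q|q'q]; last by exists q' => //; rewrite !inE q'q q'Q !orbT.
    case: (eqVneq (u `&` b) \bot) => [ub|ub]; last by exists u => //; rewrite !inE eqxx.
    exists (q `&` ~` u); first by rewrite !inE eqxx orbT.
    by apply: contra_neq q'b => qub; rewrite q'q; ba.
- move=> q'; rewrite !inE => /or3P[/eqP->|/eqP->|/andP[_ q'Q]].
  + by exists q.
  + by exists q => //; rewrite leIl.
  + by exists q'.
exists u, x, x; split=> //; first by rewrite !inE eqxx.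
rewrite -io_le ioI; ba.
Qed.


Lemma splitting_sequence (w : nat -> A) :
  (forall n, w n != \bot /\ E S (io (w n))) ->
  exists Q : nat -> {fset A}, [/\ Q 0%N = [fset \top]%fset, forall n, splitting (Q n),
    forall n m, (n <= m)%N -> refines (Q n) (Q m) & forall n, hits (Q n.+1) (w n)].
Proof.
move=> hw.
have step (Qn : {fset A} * nat) : exists Q', splitting Qn.1 ->
    [/\ splitting Q', refines Qn.1 Q' & hits Q' (w Qn.2)].
  case: (pselect (splitting Qn.1)) => [hQ|]; last by exists fset0.
  by have [w0 Ew] := hw Qn.2; have [Q' ?] := refine hQ w0 Ew; exists Q'.
have [f hf] := choice step.
pose Q := fix Q n := if n is n'.+1 then f (Q n', n') else [fset \top]%fset.
have hQ n : splitting (Q n).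
  elim: n => [|n IH]; last by case: (hf (Q n, n) IH).
  split=> [q|q q'|a a0].
  - rewrite inE => /eqP->; rewrite io1; split; last by exists \top => //; exact: (stage1 hst).
    by apply: sups_in; exact: fin_meets1.
  - by rewrite !inE => /eqP-> /eqP->; rewrite eqxx.
  - by exists \top; rewrite ?inE ?meet1x.
exists Q; split=> // [n m|n]; last by case: (hf (Q n, n) (hQ n)).
elim: m => [|m IH]; first by rewrite leqn0 => /eqP-> q qQ; exists q.
rewrite leq_eqVlt => /orP[/eqP->|]; first by move=> q qQ; exists q.
rewrite ltnS => /IH nm q /= qm.
have [_ + _] := hf (Q m, m) (hQ m) => /(_ _ qm)[q' q'm qq'].
by have [q'' q''n q'q''] := nm _ q'm; exists q'' => //; exact: le_trans q'q''.
Qed.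

End Countable.

(** * The base obtained from a tree of partitions *)

Section Tree.
Context (S : set I) (cS : index_closed ph S) (w : nat -> A).
Hypothesis w_dense : forall p, fin_meets g S p -> exists n, io (w n) <= p.
Context (Q : nat -> {fset A}) (Q0 : Q 0%N = [fset \top]%fset).
Hypotheses (Qsplit : forall n, splitting S (Q n))
  (Qref : forall n m, (n <= m)%N -> refines (Q n) (Q m))
  (Qhits : forall n, hits S (Q n.+1) (w n)).

(** Being the shadow of [y], [d] is determined by [y]; the level [n] and the node [q] may vary. *)
Definition presented n y d q := [/\ q \in Q n, X d, shadow d y & y = d `&` q].

(* Products [d `&` q] of an old element [d] and a node [q] of the tree of
   partitions such that [d] is below the shadow of [q]: the shadow of the
   product is then [d] itself. *)
Definition tree_set : set A := fun y => exists n d q, presented n y d q.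

Let EX x (Xx : X x) : E Sg (io x) := stage_sups hst Xx.
Let X1 : X \top := stage1 hst.

Lemma presented_old x : X x -> presented 0 x x \top.
Proof. by move=> Xx; split; rewrite ?Q0 ?inE ?meetx1//; exact: shadow_refl. Qed.

Lemma tree_old x : X x -> tree_set x.
Proof. by move=> Xx; exists 0%N, x, \top; exact: presented_old. Qed.

Lemma tree_neq0 y : tree_set y -> y != \bot.
Proof. by move=> [n [d [q [_ Xd sh _]]]]; apply: shadow_neq0 sh; exact: (stage_neq0 hst). Qed.

Lemma tree_le n m q q' : (n <= m)%N -> q \in Q n -> q' \in Q m ->
  q `&` q' = \bot \/ q' <= q.
Proof.
move=> nm qn q'm; have [r rn q'r] := Qref nm q'm.
case: (eqVneq q r) => [->|qr]; first by right.
by left; have [_ dis _] := Qsplit n; have e := dis _ _ qn rn qr; ba.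
Qed.

Lemma presented_node n q : q \in Q n -> exists2 d, X d & presented n q d q.
Proof.
move=> qn; have [Qq _ _] := Qsplit n; have [_ [d Xd dq]] := Qq _ qn.
by exists d => //; split=> //; case: dq => qd _; ba.
Qed.

Lemma presented_meet n m y y' d d' q q' : (n <= m)%N ->
  presented n y d q -> presented m y' d' q' -> q' <= q ->
  d `&` d' != \bot -> presented m (y `&` y') (d `&` d') q'.
Proof.
move=> nm [qn Xd [_ dmin] yE] [q'm Xd' sh' yE'] q'q dd0.
have E1 : y `&` y' = d `&` d' `&` q' by rewrite yE yE'; ba.
split=> //; first exact: (stageI hst).
have -> : y `&` y' = y' `&` d by rewrite yE yE'; ba.
by rewrite meetC; apply: shadow_meet sh'; exact: EX.
Qed.

(** d' /\ d is the shadow of y' /\ d, and only a non-zero element can have a non-zero shadow in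
    [X]. *)
Lemma presented_disjoint m y' d d' q' : X d -> presented m y' d' q' ->
  d `&` y' = \bot -> d `&` d' = \bot.
Proof.
move=> Xd [_ Xd' sh' _] dy; apply/eqP; apply: contraT => dd0.
have /shadow_neq0 : shadow (d' `&` d) (y' `&` d) by apply: shadow_meet sh'; exact: EX.
by rewrite meetC [y' `&` d]meetC dy => /(_ dd0); rewrite eqxx.
Qed.

Lemma presented_meets n m y y' d d' q q' : (n <= m)%N ->
  presented n y d q -> presented m y' d' q' -> y `&` y' != \bot ->
  presented m (y `&` y') (d `&` d') q'.
Proof.
move=> nm hy hy' yy0; apply: presented_meet (hy) (hy') _ _ => //.
- case: (hy) (hy') => qn _ _ yE [q'm _ _ yE'].
  case: (tree_le nm qn q'm) => // qq'; case/eqP: yy0; rewrite yE yE'; ba.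
- case: hy hy' => _ _ [yd _] _ [_ _ [yd' _] _].
  by apply: contra_neq yy0 => dd'; ba.
Qed.

Lemma tree_meet : nonzero_meet_closed tree_set.
Proof.
move=> y y' [n [d [q hy]]] [m [d' [q' hy']]] yy0.
have [nm|mn] := leqP n m.
  by exists m, (d `&` d'), q'; exact: (presented_meets nm hy hy').
exists n, (d' `&` d), q; rewrite [y `&` y']meetC in yy0 *.
exact: (presented_meets (ltnW mn) hy' hy).
Qed.

(** By de Morgan: the complement of [d] is a join of old elements, and that of [q] is the join of
    the other nodes of its level. *)
Lemma tree_compl y : tree_set y -> finite_joins tree_set (~` y).
Proof.
move=> [n [d [q [qn Xd sh ->]]]]; rewrite complI; apply: finite_joinsU.
  apply: finite_joins_mono (stageC hst Xd) => x Xx.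
  by apply: finite_joins_in; exact: tree_old.
exists (rem q (Q n)).
  move=> r; rewrite mem_rem_uniq ?fset_uniq// inE => /andP[_ rn].
  by have [e Xe re] := presented_node rn; exists n, e, r.
have [_ dis cov] := Qsplit n.
have remE r : (r \in rem q (Q n)) = (r != q) && (r \in Q n).
  by rewrite mem_rem_uniq ?fset_uniq// inE.
apply/le_anti/andP; split; last first.
  apply: ultra_leP => u hu; rewrite ultra_joins//; apply/implyP => /hasP[r].
  rewrite remE => /andP[rq rn] ur; rewrite ultraC//; apply/negP => uq.
  by have := ultraI hu r q; rewrite ur uq (dis _ _ rn qn rq) ultra0.
rewrite -[X in _ <= X]complK -disj_leC; apply: contraT => /cov[r rn].
case: (eqVneq r q) => [->|rq]; first by move=> h0; case/eqP: h0; ba.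
have rJ : r <= \join_(x <- rem q (Q n)) x by apply: joins_sup_seq => //; rewrite remE rq.
by move=> h0; case/eqP: h0; move: (\join_(x <- _) x) rJ => J rJ; ba.
Qed.


Lemma tree_sups y : tree_set y -> E (Sg `|` S)%classic (io y).
Proof.
move=> [n [d [q [qn Xd _ ->]]]]; rewrite ioI.
apply: supsI; first exact: fin_meets_meet.
  by apply: sups_mono (EX Xd); apply: fin_meets_mono => i; left.
have [Qq _ _] := Qsplit n; have [Eq _] := Qq _ qn.
by apply: sups_mono Eq; apply: fin_meets_mono => i; right.
Qed.

(** Split [p] into [t] over [Sg] and [p'] over [S]. The projection [v] of [t] to [S] also lies in
    [E Sg], so a hit x /\ q below p' /\ v has its shadow [x] below [v]; then [x] meets [t], and an
    old x' <= x below [t] gives x' /\ q below [p]. *)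
Lemma tree_dense p : fin_meets g (Sg `|` S)%classic p -> exists2 y, tree_set y & io y <= p.
Proof.
move=> Up; have p0 := Up.1; have [t [p' [St Sp' pE]]] := fin_meetsU Up.
have [v [Sv Sgv tv vmin]] := projection_exists hrich cS cSg St.
have pv0 : p' `&` v != \bot by apply: contra_neq p0 => e; ba.
have [|p3 [Sp3 p30 p3pv]] := sups_below (D := fin_meets g S) _ pv0.
  by apply: supsI => //; [exact: fin_meets_meet|exact: sups_in].
have [n wn] := w_dense Sp3.
have [q [d [x [qn [dq Xd] [Xx Ex] xd xqw]]]] := Qhits n.
have sub z : z <= d -> X z -> shadow z (z `&` q).
  move=> zd Xz; have := shadow_meet (EX Xz) dq.
  by rewrite (meet_idPr zd) meetC.
have ioxq : io (x `&` q) <= io (w n) by rewrite io_le.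
have xv : io x <= v by have [_] := sub _ xd Xx; apply=> //; ba.
have xt0 : io x `&` t != \bot.
  apply/eqP => xt; have h1 : v <= ~` io x.
    by apply: vmin; [exact: (sups_compl hrich)|ba].
  have := stage_neq0 hst Xx; rewrite -io_eq0 => /eqP; apply; ba.
have [|p5 [Sp5 p50 p5xt]] := sups_below (D := fin_meets g Sg) _ xt0.
  by apply: supsI; [exact: fin_meets_meet|exact: EX|exact: sups_in].
have [x' Xx' x'p5] := stage_dense hst Sp5.
have x'x : x' <= x by rewrite -io_le; ba.
exists (x' `&` q).
  exists n.+1, x', q; split=> //; apply: sub => //; exact: le_trans xd.
have : io (x' `&` q) <= io (x `&` q) by rewrite io_le leI2.
rewrite ioI => h1; ba.
Qed.

(** Let d /\ q and d' /\ q' be disjoint, [q] being of the lower level. Either the nodes are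
    disjoint, and [q] and the node above [q'] at the level of [q] separate; or q' <= q, so [d] and
    [d'] are disjoint and [s] separates them. Coherence holds since the shadow of a meet is the meet
    of the shadows. *)
Lemma tree_stage : exists s', stage (Sg `|` S)%classic tree_set s' /\
  forall x, X x -> s' x = s x.
Proof.
(* A presentation of least level is chosen: by [presented_meets], the level of a meet is then at
   most the larger level of its factors. *)
have [f hf] : {f : A -> nat * A * A & forall y, tree_set y ->
    presented (f y).1.1 y (f y).1.2 (f y).2 /\
    forall m d q, presented m y d q -> ((f y).1.1 <= m)%N}.
  apply: (@choice _ _ (fun y t => tree_set y -> presented t.1.1 y t.1.2 t.2 /\
    forall m d q, presented m y d q -> (t.1.1 <= m)%N)) => y.
  case: (pselect (tree_set y)) => [ty|]; last by exists (0%N, y, y).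
  pose P n := `[< exists d q, presented n y d q >].
  have exP : exists n, P n.
    by case: ty => n [d [q hn]]; exists n; apply/asboolP; exists d, q.
  case: (ex_minnP exP) => n /asboolP[d [q hn]] minn.
  exists (n, d, q) => _; split=> // m d' q' hm; apply: minn.
  by apply/asboolP; exists d', q'.
pose lv y := (f y).1.1; pose dd y := (f y).1.2; pose qq y := (f y).2.
have fP y : tree_set y -> presented (lv y) y (dd y) (qq y) by move=> /hf[].
have fmin y m d q : presented m y d q -> (lv y <= m)%N.
  by move=> h1; have [|_ h2] := hf y; [exists m, d, q|exact: h2 h1].
have ddE y m d q : presented m y d q -> dd y = d.
  move=> h1; have [|_ Xd sd _] := fP y; first by exists m, d, q.
  by case: h1 => _ Xd' sd' _; apply: shadow_uniq sd sd'; exact: EX.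
pose s' y := seq_fset tt (s (dd y) ++ flatten [seq (Q k : seq A) | k <- iota 0 (lv y).+1]).
have s'P y c : c \in s' y <-> c \in s (dd y) \/ exists2 k, (k <= lv y)%N & c \in Q k.
  rewrite seq_fsetE mem_cat; split=> [/orP[|/flattenP[_ /mapP[k kl ->]] ck]|[->//|[k kl ck]]].
  - by left.
  - by right; exists k => //; move: kl; rewrite mem_iota add0n.
  - apply/orP; right; apply/flattenP; exists (Q k : seq A) => //.
    by apply/mapP; exists k => //; rewrite mem_iota add0n.
have QX' k c : c \in Q k -> tree_set c.
  by move=> ck; have [e Xe hc] := presented_node ck; exists k, e, c.
have [[sX sepX] cohX] := stage_sep hst.
have sep y y' : (lv y <= lv y')%N -> tree_set y -> tree_set y' -> y `&` y' = \bot ->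
    exists c c' : A, [/\ c \in (s' y `&` s' y')%fset, c' \in (s' y `&` s' y')%fset,
                   c `&` c' = \bot, y <= c & y' <= c'].
  move=> ll ty ty' yy0.
  have h1 := fP _ ty; have h2 := fP _ ty'.
  have [qn Xd sd yE] := h1; have [qn' Xd' sd' yE'] := h2.
  case: (eqVneq (qq y `&` qq y') \bot) => [qq0|qq0].
    have [r rn q'r] := Qref ll qn'; exists (qq y), r; split.
    - by rewrite inE; apply/andP; split; apply/s'P; right; exists (lv y).
    - by rewrite inE; apply/andP; split; apply/s'P; right; exists (lv y).
    - have [_ dis _] := Qsplit (lv y); apply: dis => //.
      have : qq y' != \bot by apply: tree_neq0; exact: QX' qn'.
      by apply: contra_neq => e; rewrite -e in q'r; ba.
    - by clear -yE; ba.
    - by clear -yE' q'r; ba.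
  have q'q : qq y' <= qq y.
    by case: (tree_le ll qn qn') => // e; rewrite e eqxx in qq0.
  have dy' : dd y `&` y' = \bot by rewrite yE yE' in yy0; rewrite yE'; ba.
  have dd0 := presented_disjoint Xd h2 dy'.
  have [c [e [+ + ce dc de]]] := sepX _ _ Xd Xd' dd0.
  rewrite !inE => /andP[c1 c2] /andP[e1 e2]; exists c, e; split=> //.
  - by rewrite inE; apply/andP; split; apply/s'P; left.
  - by rewrite inE; apply/andP; split; apply/s'P; left.
  - by case: sd => yd _; exact: le_trans dc.
  - by case: sd' => yd _; exact: le_trans de.
have coh y y' : (lv y <= lv y')%N -> tree_set y -> tree_set y' -> y `&` y' != \bot ->
    forall c, c \in s' (y `&` y') -> nonzero_meets (s' y `|` s' y')%fset c.
  move=> ll ty ty' yy0 c.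
  have h1 := fP _ ty; have h2 := fP _ ty'.
  have h3 := presented_meets ll h1 h2 yy0.
  move/s'P; rewrite (ddE _ _ _ _ h3) => -[cdd|[k kl ck]].
    have [_ Xd _ _] := h1; have [_ Xd' _ _] := h2.
    have dd0 : dd y `&` dd y' != \bot by have [_ /(stage_neq0 hst)] := h3.
    apply: nonzero_meets_mono (cohX _ _ Xd Xd' dd0 _ cdd).
    by apply/fsubsetP => e; rewrite !inE => /orP[] he; apply/orP; [left|right]; apply/s'P; left.
  apply: nonzero_meets_in; last by apply: tree_neq0; exact: QX' ck.
  rewrite inE; apply/orP; right; apply/s'P; right; exists k => //.
  exact: leq_trans kl (fmin _ _ _ _ h3).
(* Old elements have level 0, whose only node is top; it belongs to [s x] by [stage_top], so the
   values on [X] do not change. *)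
exists s'; split; last first.
  move=> x Xx; have h1 := presented_old Xx.
  apply/fsetP => c; apply/idP/idP => [/s'P|cs].
    rewrite (ddE _ _ _ _ h1) => -[//|[k]].
    have := fmin _ _ _ _ h1; rewrite leqn0 => /eqP->; rewrite leqn0 => /eqP->.
    by rewrite Q0 inE => /eqP->; exact: (stage_top hst).
  by apply/s'P; left; rewrite (ddE _ _ _ _ h1).
split.
- exact: index_closedU.
- exact: tree_neq0.
- exact: tree_sups.
- exact: tree_old.
- exact: tree_meet.
- exact: tree_compl.
- exact: tree_dense.
- by move=> y ty; apply/s'P; left; apply: (stage_top hst); have [] := fP _ ty.
split; [split=> [y ty c /s'P[cs|[k _ /QX'//]]|y y' ty ty' yy0]|move=> y y' ty ty' yy0 c cs].
- by apply: tree_old; apply: sX cs; have [] := fP _ ty.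
- have [ll|/ltnW ll] := leqP (lv y) (lv y'); first exact: sep.
  have [|c [e [h1 h2 ce yc ye]]] := sep _ _ ll ty' ty; first by rewrite meetC.
  by exists e, c; split=> //; rewrite 1?fsetIC// meetC.
- have [ll|/ltnW ll] := leqP (lv y) (lv y'); first exact: coh.
  by rewrite fsetUC; apply: coh => //; rewrite meetC.
Qed.

End Tree.
End Extend.

(** A countable set containing [i] is closed under [ph] and under supports of two kinds of chosen
    elements: [al l] of [A] below the finite meet [m l], and [xi l] of [X] below the projection of
    [m l] to [Sg]. The tree is built over this set. *)
Lemma stage_extend Sg X s i : stage Sg X s -> exists Sg' X' s',
  [/\ stage Sg' X' s', (Sg `<=` Sg')%classic, Sg' i, (X `<=` X')%classic &
      forall x, X x -> s' x = s x].
Proof.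
move=> hst; pose m l := \meet_(i <- l) g i.
have A1 : \top != \bot :> A by exact: (stage_neq0 hst (stage1 hst)).
have mT l : m l != \bot -> fin_meets g setT (m l) by move=> ml; split=> //; exists l.
have [al hal] : {al : seq I -> A & forall l, al l != \bot /\ (m l != \bot -> io (al l) <= m l)}.
  apply: (@choice _ _ (fun l a => a != \bot /\ (m l != \bot -> io a <= m l))) => l.
  case: (eqVneq (m l) \bot) => [_|/io_dense[a a0 am]]; first by exists \top.
  by exists a.
have [xi hxi] : {xi : seq I -> A & forall l, X (xi l) /\
    (m l != \bot -> forall e, E Sg e -> m l <= e -> io (xi l) <= e)}.
  apply: (@choice _ _ (fun l x => X x /\
    (m l != \bot -> forall e, E Sg e -> m l <= e -> io x <= e))) => l.
  case: (eqVneq (m l) \bot) => [_|ml0]; first by exists \top; split=> //; exact: (stage1 hst).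
  have [w [Sgw _ lw wmin]] := projection_exists hrich (stage_closed hst) (@index_closedT _ ph) (mT _ ml0).
  have [|p [Sp _ pw]] := sups_below Sgw; first by apply: contra_neq ml0 => w0; ba.
  have [x Xx xp] := stage_dense hst Sp; exists x; split=> // _ e Ee le.
  by have := wmin _ Ee le => we; ba.
have [zz hzz] := choice (countable_support (rich_dense hrich) (rich_bdd hrich)).
(* [ph] is applied to the head of a list only; one-element lists then give [index_closed]. *)
pose F l n := ph (head i l) n ++ zz (io (al l)) n ++ zz (io (xi l)) n.
have [z [zi zF _]] := countable_closure i F.
have cS : index_closed ph (range z).
  move=> j n k zj jk; apply: (zF [:: j] n) => [k'|]; first by rewrite inE => /eqP->.
  by rewrite mem_cat jk.
have Eal l : (forall i, i \in l -> range z i) -> E (range z) (io (al l)).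
  move=> lz; apply: hzz => n j jz; apply: (zF l n) => //.
  by rewrite !mem_cat jz !orbT.
have Exi l : (forall i, i \in l -> range z i) -> E (range z) (io (xi l)).
  move=> lz; apply: hzz => n j jz; apply: (zF l n) => //.
  by rewrite !mem_cat jz !orbT.
have S_A p : fin_meets g (range z) p -> exists a, [/\ a != \bot, io a <= p & E (range z) (io a)].
  move=> [p0 [l lz pE]]; have [a0 am] := hal l; exists (al l); split=> //; last exact: Eal.
  by rewrite pE; apply: am; rewrite /m -pE.
have S_X p : fin_meets g (range z) p -> exists x, [/\ X x, E (range z) (io x) &
    forall e, E Sg e -> p <= e -> io x <= e].
  move=> [p0 [l lz pE]]; have [Xx xm] := hxi l; exists (xi l); split=> //; first exact: Exi.
  by rewrite pE; apply: xm; rewrite /m -pE.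
pose w (n : nat) := al (map z (odflt [::] (choice.unpickle n))).
have zr l : forall i, i \in map z l -> range z i by move=> j /mapP[n _ ->]; exists n.
have [|Q [Q0 Qs Qr Qh]] := @splitting_sequence Sg X s hst _ cS S_A S_X w.
  by move=> n; split; [case: (hal (map z (odflt [::] (choice.unpickle n))))|apply: Eal; exact: zr].
have w_dense p : fin_meets g (range z) p -> exists n, io (w n) <= p.
  move=> [p0 [l lz pE]].
  have [l' lE] : exists l', l = map z l'.
    elim: l lz {pE} => [|k l IH] lz; first by exists [::].
    have [n _ <-] := lz k (mem_head _ _).
    have [|l' ->] := IH; last by exists (n :: l').
    by move=> j jl; apply: lz; rewrite inE jl orbT.
  exists (choice.pickle l'); rewrite /w choice.pickleK /= -lE pE.
  by have [_] := hal l; apply; rewrite /m -pE.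
have [s' [hs' ss']] := tree_stage hst cS w_dense Q0 Qs Qr Qh.
exists (Sg `|` range z)%classic, (tree_set Sg X Q), s'; split=> //.
- by right.
- by move=> x; exact: tree_old.
Qed.

Lemma stage_init : nondegenerate A -> stage set0 [set \top]%classic (fun=> [fset \top]%fset).
Proof.
rewrite /nondegenerate eq_sym => A1; split.
- by [].
- by move=> _ ->.
- by move=> _ ->; rewrite io1; apply: sups_in; exact: fin_meets1.
- by [].
- by move=> _ _ -> -> _; rewrite /= meetxx.
- by move=> _ ->; rewrite compl1; exact: finite_joins0.
- move=> p [_ [[|i l] l0 ->]]; last by have := l0 i (mem_head _ _).
  by exists \top => //; rewrite big_nil lex1.
- by move=> x _; rewrite inE.
- split; [split=> [a _ c|_ _ -> ->]|move=> _ _ -> -> _ c].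
  + by rewrite inE => /eqP.
  + by rewrite meetxx => e; rewrite e eqxx in A1.
  + by rewrite inE => /eqP ->; apply: nonzero_meets_in => //; rewrite !inE eqxx.
Qed.

(** Zorn's lemma on stages: a maximal stage contains every index by [stage_extend], and its density
    in [B] restricts to [A] through [io]. *)
Lemma exists_base : nondegenerate A -> exists X s,
  [/\ pi_base X, X \top, nonzero_meet_closed X,
      forall x, X x -> finite_joins X (~` x) & coherent_finite_separation X s].
Proof.
move=> And.
pose T := {t : set I * set A * (A -> {fset A}) | `[< stage t.1.1 t.1.2 t.2 >]}.
have TP (t : T) : stage (val t).1.1 (val t).1.2 (val t).2 by exact/asboolP/(valP t).
(* Values of the maps outside [X] are ignored, so this is only a preorder; agreement on [X] lets the
   maps of a chain be glued. *)
pose le (t u : T) := [/\ ((val t).1.1 `<=` (val u).1.1)%classic, ((val t).1.2 `<=` (val u).1.2)%classic &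
  forall x, (val t).1.2 x -> (val u).2 x = (val t).2 x].
have le_refl t : le t t by split.
pose R (t u : T) : bool := `[< le t u >].
pose mk Sg X s (hst : stage Sg X s) : T := exist _ (Sg, X, s) (asboolT hst).
have [| | |t tmax] := @ZL_preorder T (mk _ _ _ (stage_init And)) R.
- by move=> t; apply/asboolP; exact: le_refl.
- move=> t u v /asboolP[h1 h2 h3] /asboolP[k1 k2 k3]; apply/asboolP; split.
  + by move=> i /h1/k1.
  + by move=> x /h2/k2.
  + by move=> x tx; rewrite k3 ?h3//; exact: h2.
- move=> C Ctot.
  case: (pselect (exists t, C t)) => [[t0 Ct0]|nC]; last first.
    by exists (mk _ _ _ (stage_init And)) => t Ct; case: nC; exists t.
  pose Sg := (\bigcup_(t in C) (val t).1.1)%classic.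
  pose X := (\bigcup_(t in C) (val t).1.2)%classic.
  have [s hs] : {s : A -> {fset A} & forall x, X x -> exists t, [/\ C t, (val t).1.2 x & s x = (val t).2 x]}.
    apply: (@choice _ _ (fun x sx => X x -> exists t, [/\ C t, (val t).1.2 x & sx = (val t).2 x])) => x.
    case: (pselect (X x)) => [[t Ct tx]|]; last by exists fset0.
    by exists ((val t).2 x) => _; exists t.
  have two t u : C t -> C u -> exists v, [/\ C v, le t v & le u v].
    move=> Ct Cu; have [/asboolP tu|/asboolP ut] := Ctot _ _ Ct Cu.
    + by exists u; split=> //; exact: le_refl.
    + by exists t; split=> //; exact: le_refl.
  have sE t x : C t -> (val t).1.2 x -> s x = (val t).2 x.
    move=> Ct tx; have [|u [Cu ux ->]] := hs x; first by exists t.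
    by have [v [Cv [_ _ h1] [_ _ h2]]] := two _ _ Ct Cu; rewrite -h1// -h2.
  have XX x y : X x -> X y -> exists t, [/\ C t, (val t).1.2 x & (val t).1.2 y].
    move=> [t Ct tx] [u Cu uy]; have [v [Cv [_ h1 _] [_ h2 _]]] := two _ _ Ct Cu.
    by exists v; split=> //; [exact: h1|exact: h2].
  (* Each condition concerns finitely many elements or indices of the union, which lie in one member
     of the chain. *)
  have hst : stage Sg X s.
    split.
    + by move=> i n j [t Ct ti] ij; exists t => //; apply: (stage_closed (TP t)) ij.
    + by move=> x [t Ct tx]; exact: (stage_neq0 (TP t)).
    + move=> x [t Ct tx]; apply: sups_mono (stage_sups (TP t) tx).
      by apply: fin_meets_mono => i ti; exists t.
    + by exists t0 => //; exact: (stage1 (TP t0)).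
    + by move=> x y /XX h1 /h1[t [Ct tx ty]] xy; exists t => //; exact: (stageI (TP t)).
    + move=> x [t Ct tx]; apply: finite_joins_mono (stageC (TP t) tx) => y ty.
      by apply: finite_joins_in; exists t.
    + move=> p Sp.
      have [|||S [t Ct <-] tp] := @fin_meets_chain _ _ _ g [set (val t).1.1 | t in C]%classic p.
      * by exists (val t0).1.1, t0.
      * move=> _ _ [t Ct <-] [u Cu <-].
        by have [/asboolP[]|/asboolP[]] := Ctot _ _ Ct Cu; [left|right].
      * by rewrite bigcup_image.
      * by have [x tx xp] := stage_dense (TP t) tp; exists x => //; exists t.
    + by move=> x [t Ct tx]; rewrite (sE t)//; exact: (stage_top (TP t)).
    + split; [split=> [x [t Ct tx] c|x y /XX h1 /h1[t [Ct tx ty]]]|move=> x y /XX h1 /h1[t [Ct tx ty]] xy0 c].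
      * by rewrite (sE t)// => cs; exists t => //; have [[h1 _] _] := stage_sep (TP t); exact: h1 cs.
      * by rewrite !(sE t)//; have [[_ h2] _] := stage_sep (TP t); exact: h2.
      * rewrite !(sE t)//; last exact: (stageI (TP t)).
        by have [_ h2] := stage_sep (TP t); exact: h2.
  exists (mk _ _ _ hst) => t Ct; apply/asboolP; split.
  + by move=> i ti; exists t.
  + by move=> x tx; exists t.
  + by move=> x tx; exact: sE.
have tT i : (val t).1.1 i.
  have [Sg' [X' [s' [hst h1 Si h2 h3]]]] := stage_extend i (TP t).
  have /asboolP[h4 _ _] : R (mk _ _ _ hst) t by apply: tmax; apply/asboolP.
  exact: h4.
exists (val t).1.2, (val t).2; split.
- split=> [x|a a0]; first exact: (stage_neq0 (TP t)).
  have [|p Tp pa] := rich_dense hrich (b := io a); first by rewrite io_eq0.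
  have [|x tx xp] := stage_dense (TP t) (p := p).
    by apply: fin_meets_mono Tp => i _.
  by exists x => //; rewrite -io_le; exact: le_trans pa.
- exact: (stage1 (TP t)).
- exact: (stageI (TP t)).
- exact: (stageC (TP t)).
- exact: (stage_sep (TP t)).
Qed.

End Stage.

(** * Coherent finite-separation maps *)

Section Adjoin.
Context d (A : ctbDistrLatticeType d).
Implicit Types (X : set A).

(* The value at [\top] is irrelevant, as no non-zero element is disjoint from
   [\top]. *)
Lemma adjoin_top X s : nondegenerate A -> pi_base X -> nonzero_meet_closed X ->
    coherent_finite_separation X s ->
  let X' := (X `|` [set \top])%classic in
  exists s', [/\ pi_base X', X' \top, nonzero_meet_closed X',
    s' \top = fset0 & coherent_finite_separation X' s'].
Proof.
move=> And [X0 Xd] XI [[sX sep] coh].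
exists (fun x => if x == \top then fset0 else s x).
split; rewrite ?eqxx//; first split.
- by move=> x [/X0//|->]; rewrite eq_sym.
- by move=> a /Xd[x Xx xa]; exists x => //; left.
- by right.
- move=> a b [Xa|->] [Xb|->]; rewrite ?meetx1 ?meet1x.
  + by left; apply: XI.
  + by left.
  + by left.
  + by right.
have X'0 a : (X `|` [set \top])%classic a -> a != \bot.
  by move=> [/X0//|->]; rewrite eq_sym.
have old a : (X `|` [set \top])%classic a -> a != \top -> X a by move=> [//|->]; rewrite eqxx.
split; [split=> [a Xa c|a b Xa Xb ab]|move=> a b Xa Xb ab c].
- by case: eqVneq => // a1 ca; left; apply: sX ca; exact: old.
- case: eqVneq => [a1|/(old _ Xa) Xa']; first by have := X'0 _ Xb; move: ab; rewrite a1 meet1x => ->; rewrite eqxx.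
  case: eqVneq => [b1|/(old _ Xb) Xb']; last exact: sep.
  by have := X'0 _ Xa; move: ab; rewrite b1 meetx1 => ->; rewrite eqxx.
- have [->|a1] := eqVneq a \top.
    rewrite meet1x fset0U; case: eqVneq => // b1 cb.
    by apply: nonzero_meets_in => //; apply: X0; apply: sX cb; exact: old.
  have [->|b1] := eqVneq b \top.
    rewrite meetx1 fsetU0 (negbTE a1) => ca.
    by apply: nonzero_meets_in => //; apply: X0; apply: sX ca; exact: old.
  rewrite ifF; first by apply: coh => //; exact: old.
  by apply: contraNF a1 => /eqP ab1; apply/eqP; ba.
Qed.

End Adjoin.

(** * From a coherent finite-separation map to a rich algebra *)

Section FromSeparation.
Context d (A : ctbDistrLatticeType d) (X : set A) (s : A -> {fset A}).
Hypotheses (And : nondegenerate A) (Xbase : pi_base X) (X1 : X \top)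
  (XI : nonzero_meet_closed X) (s1 : s \top = fset0)
  (Xs : coherent_finite_separation X s).

Let I := {x : A | `[< X x >]}.
Let g : I -> A := val.
Let gX (i : I) : X (g i). Proof. exact/asboolP/(valP i). Qed.
Let mk x (Xx : X x) : I := exist _ x (asboolT Xx).

(** Closure under non-zero meets keeps finite meets inside [X]; [X1] takes care of the empty
    meet. *)
Lemma fin_meets_sub S x : fin_meets g S x -> X x.
Proof.
move=> [x0 [l lS xE]]; rewrite {}xE in x0 *; elim: l {lS} x0 => [|i l IH]; first by rewrite big_nil.
rewrite big_cons => il0; apply: XI => //; apply: IH.
by apply: contra_neq il0 => ->; rewrite meetx0.
Qed.

Lemma fin_meets_all x : X x -> fin_meets g setT x.
Proof. by move=> Xx; apply: (@fin_meets_gen _ _ _ g setT (mk Xx)) => //; exact: (Xbase.1). Qed.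

Definition size_class k : set A := fun x => (size (s x) <= k)%N.

(** Of two disjoint elements only [x] lies below the separator [c], which belongs to both values of
    [s]; so they conflict at [c] and [conflict_bound] applies. *)
Lemma size_class_bdd : bounded_antichains (fin_meets g setT) size_class.
Proof.
split=> [b _|k]; first by exists (size (s b)); exact: leqnn.
have [N HN] := @conflict_bound A A (fun x c => x <= c) k.
exists N => L hL pL; apply: (HN (fun x => s x : seq A)).
  by apply/allP => x /hL[].
have : all (fun x => `[< X x >]) L by apply/allP => x /hL[/fin_meets_sub ? _]; apply/asboolP.
move=> XL; apply: sub_in_pairwise XL pL => x y /asboolP Xx /asboolP Xy /eqP xy0.
have [c [e [+ _ ce xc ye]]] := Xs.1.2 _ _ Xx Xy xy0; rewrite inE => /andP[cx cy].
apply/hasP; exists c => //; rewrite cy xc/=; apply: contraNneq (Xbase.1 _ Xy) => yc.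
by have {}yc : y <= c by []; ba.
Qed.

Lemma dense_meets b : b != \bot -> exists2 p, fin_meets g setT p & p <= b.
Proof. by move=> /(Xbase.2)[x Xx xb]; exists x => //; exact: fin_meets_all. Qed.

(** The companions of a generator are the members of its value under [s] and a countable support of
    its complement. The former keep separators over [S], the latter keep complements there. *)
Lemma separation_rich : exists ph, rich g ph size_class.
Proof.
have [zz hzz] := choice (countable_support dense_meets size_class_bdd).
pose ph (i : I) (n : nat) : seq I := pmap insub (s (g i) : seq A) ++ zz (~` g i) n.
exists ph.
(* By coherence and induction on the length of the meet; the empty meet has an empty value by
   [s1]. *)
have sS S x c : index_closed ph S -> fin_meets g S x -> c \in s x -> fin_meets g S c.
  move=> cS [x0 [l lS xE]]; rewrite {}xE in x0 *; elim: l lS c x0 => [|i l IH] lS c x0.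
    by rewrite big_nil s1.
  rewrite big_cons in x0 *; set r := \big[_/_]_(i <- l) g i in IH x0 *.
  have Si : S i by apply: lS; rewrite mem_head.
  have r0 : r != \bot by apply: contra_neq x0 => ->; rewrite meetx0.
  have lS' j : j \in l -> S j by move=> jl; apply: lS; rewrite inE jl orbT.
  have Sr : fin_meets g S r by split=> //; exists l.
  move=> /(Xs.2 _ _ (gX i) (fin_meets_sub Sr) x0)[c0 [G [_ GF cE]]].
  have GS y : y \in enum_fset G -> fin_meets g S y.
    move=> /(fsubsetP GF); rewrite inE => /orP[ys|]; last exact: IH.
    have Xy : X y by exact: (Xs.1.1 _ (gX i)).
    apply: (@fin_meets_gen _ _ _ g S (mk Xy)); last exact: (Xbase.1).
    by apply: (cS i 0%N) => //; rewrite mem_cat mem_pmap_sub ys.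
  rewrite {}cE in c0 *; move: GS c0; elim: (enum_fset G) => [|y m IHm] mS m0.
    by rewrite big_nil; exact: fin_meets1.
  rewrite big_cons in m0 *; apply: fin_meets_meet (m0); first exact: (mS _ (mem_head _ _)).
  apply: IHm => [z zm|]; first by apply: mS; rewrite inE zm orbT.
  by apply: contra_neq m0 => ->; rewrite meetx0.
have Cd S x : index_closed ph S -> fin_meets g S x -> sups (fin_meets g S) (~` x).
  move=> cS [x0 [l lS ->]]; rewrite compl_meets -(big_map _ predT id).
  apply: sups_joins => _ /mapP[i /lS Si ->]; apply: hzz => n j jz.
  by apply: (cS i n) => //; rewrite mem_cat jz orbT.
split; [exact: dense_meets|exact: size_class_bdd|].
move=> S T t cS cT Tt.
pose ds := [seq c <- s t | `[< fin_meets g S c >] && (c `&` t == \bot)].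
have sups_ds R : index_closed ph R -> (forall c, c \in ds -> fin_meets g R c) ->
    sups (fin_meets g R) (\meet_(c <- ds) ~` c).
  move=> cR; elim: ds => [|c l IH] lR.
    by rewrite big_nil; apply: sups_in; exact: fin_meets1.
  rewrite big_cons; apply: supsI; first exact: fin_meets_meet.
    by apply: Cd => //; apply: lR; rewrite mem_head.
  by apply: IH => e el; apply: lR; rewrite inE el orbT.
exists (\meet_(c <- ds) ~` c); split.
- by apply: sups_ds => // c; rewrite mem_filter => /andP[/andP[/asboolP]].
- by apply: sups_ds => // c; rewrite mem_filter => /andP[_]; exact: sS.
- apply/meetsP_seq => c; rewrite mem_filter => /andP[/andP[_ /eqP ct] _] _; ba.
(* The separator [c] above [p] lies in [s p], hence over [S], and is disjoint from [t]; so [c]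
   occurs in [ds], and [p] misses the projection. *)
move=> p Sp pt.
have [c [e [+ _ ce pc te]]] := Xs.1.2 _ _ (fin_meets_sub Sp) (fin_meets_sub Tt) pt.
rewrite inE => /andP[cp ct].
have cds : c \in ds.
  rewrite mem_filter ct andbT; apply/andP; split; first by apply/asboolP; exact: (sS S p).
  by ba.
have : \meet_(c <- ds) ~` c <= ~` c by apply: meets_inf_seq cds _.
by move: (\meet_(_ <- _) _) => w wc; ba.
Qed.

End FromSeparation.

(** The construction is run with B = A and the identity embedding; its gain is that complements
    become finite joins. The second use of [adjoin_top] serves to empty the value at top. *)
Lemma exists_complemented_base d (A : ctbDistrLatticeType d) (X : set A) (s : A -> {fset A}) :
    nondegenerate A -> pi_base X -> nonzero_meet_closed X ->
    coherent_finite_separation X s ->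
  exists (X' : set A) (s' : A -> {fset A}),
   [/\ pi_base X', X' \top, nonzero_meet_closed X',
      forall x, X' x -> finite_joins X' (~` x) &
      s' \top = fset0 /\ coherent_finite_separation X' s'].
Proof.
move=> And Xb XI Xs.
have [s' [Xb' X1 XI' s1 Xs']] := adjoin_top And Xb XI Xs.
have [ph hrich] := separation_rich And Xb' X1 XI' s1 Xs'.
have [] := @exists_base _ _ _ _ _ _ hrich _ A id => //.
  by move=> b b0; exists b.
move=> Y [r [Yb Y1 YI YC Yr]].
have [r' [Yb' Y1' YI' r1 Yr']] := adjoin_top And Yb YI Yr.
exists (Y `|` [set \top])%classic, r'; split=> // x [/YC|->].
  by apply: finite_joins_mono => y Yy; apply: finite_joins_in; left.
by rewrite compl1; exact: finite_joins0.
Qed.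

(** * Projective algebras *)

Section Free.
Context d (P : ctbDistrLatticeType d).
Implicit Types (U V : set (set P)) (v : set P) (F : seq P) (p : P) (u : P -> bool).

(** [U] is a set of points of the Cantor cube and [F] a support of it; a set with a finite support
    is clopen. *)
Definition depends F U := forall v v', (forall i, i \in F -> (v i <-> v' i)) -> U v -> U v'.

Lemma dependsI F F' U V : depends F U -> depends F' V -> depends (F ++ F') (U `&` V)%classic.
Proof.
move=> hU hV v v' vv [Uv Vv]; split.
- by apply: hU Uv => i iF; apply: vv; rewrite mem_cat iF.
- by apply: hV Vv => i iF; apply: vv; rewrite mem_cat iF orbT.
Qed.

Lemma dependsC F U : depends F U -> depends F (~` U)%classic.
Proof. by move=> hU v v' vv nU Uv'; apply: nU; apply: hU Uv' => i /vv[]. Qed.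

Program Definition free_carrier : subalgebra (set (set P)) :=
  @Subalgebra _ (set (set P)) (fun U => exists F, depends F U) _ _ _.
Next Obligation. by exists [::]. Qed.
Next Obligation.
by move=> U V [F hU] [F' hV]; exists (F ++ F'); exact: dependsI.
Qed.
Next Obligation. by move=> U [F hU]; exists F; exact: dependsC. Qed.

(* The free Boolean algebra on the set [P], as the algebra of clopen subsets
   of the Cantor cube [set P]. *)
Definition free := subalg free_carrier.

Definition as_set u : set P := fun i => u i.

(* [p] is the image of [U] when each generator [i] is interpreted by itself. *)
Definition value U p := forall u, ultra u -> (U (as_set u) <-> u p).

Lemma value_uniq U p p' : value U p -> value U p' -> p = p'.
Proof.
move=> h h'; apply: ultra_eqP => u hu; apply/idP/idP.
- by move=> /(h _ hu)/(h' _ hu).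
- by move=> /(h' _ hu)/(h _ hu).
Qed.

Lemma valueI U V p q : value U p -> value V q -> value (U `&` V)%classic (p `&` q).
Proof.
move=> h h' u hu; rewrite ultraI//; split=> [[/(h _ hu) -> /(h' _ hu) ->]//|].
by move=> /andP[/(h _ hu) ? /(h' _ hu) ?].
Qed.

Lemma valueC U p : value U p -> value (~` U)%classic (~` p).
Proof.
move=> h u hu; rewrite ultraC//; split=> [nU|/negP np /(h _ hu)//].
by apply/negP => /(h _ hu).
Qed.

Lemma value_coord p : value [set v | v p]%classic p. Proof. by []. Qed.

(** Shannon expansion: fixing the coordinate [i] either way leaves a set supported by [F]. The
    predicate [Q] records that the value is a lattice combination of literals, which later places it
    in prescribed completions. *)
Lemma depends_value (Q : set P) F U : Q \bot -> Q \top ->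
    (forall p q, Q p -> Q q -> Q (p `&` q)) -> (forall p q, Q p -> Q q -> Q (p `|` q)) ->
    (forall i, i \in F -> Q i /\ Q (~` i)) ->
  depends F U -> exists2 p, Q p & value U p.
Proof.
move=> Q0 Q1 QI QU; elim: F U => [|i F IH] U QF hU.
  case: (pselect (U set0)) => U0.
    exists \top => // u hu; rewrite ultra1//; split=> // _.
    by apply: hU U0.
  exists \bot => // u hu; rewrite ultra0//; split=> // Uu.
  by case: U0; apply: hU Uu.
pose upd (b : Prop) v : set P := fun k => if k == i then b else v k.
have updD b : depends F [set v | U (upd b v)]%classic.
  move=> v v' vv /=; apply: hU => k; rewrite inE /upd; case: eqVneq => //= _; exact: vv.
have QF' k : k \in F -> Q k /\ Q (~` k) by move=> kF; apply: QF; rewrite inE kF orbT.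
have [p1 Qp1 h1] := IH _ QF' (updD True).
have [p0 Qp0 h0] := IH _ QF' (updD False).
have [Qi Qci] := QF i (mem_head _ _).
exists ((i `&` p1) `|` (~` i `&` p0)); first by apply: (QU) => //; exact: (QI).
move=> u hu; rewrite (ultraU hu) !(ultraI hu) (ultraC hu).
have updE (b : Prop) : (b <-> u i) -> upd b (as_set u) = as_set u.
  by move=> ub; apply/funext => k; rewrite /upd; case: eqVneq => // ->; apply: propext.
case E : (u i) => /=.
  by rewrite orbF -(h1 _ hu) /= updE// E.
by rewrite -(h0 _ hu) /= updE// E.
Qed.

Lemma free_value : {f : free -> P | homomorphism f & forall U : free, value (val U) (f U)}.
Proof.
have [f hf] : {f : free -> P & forall U : free, value (val U) (f U)}.
  apply: (@choice _ _ (fun (U : free) p => value (val U) p)) => U.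
  by have [F hF] := subP U; have [p _ hp] := @depends_value setT F _ I I (fun _ _ _ _ => I) (fun _ _ _ _ => I) (fun _ _ => conj I I) hF; exists p.
exists f => //.
have fI : {morph f : x y / x `&` y}.
  by move=> U V; apply: value_uniq (hf _) _; exact: valueI (hf _) (hf _).
have fC : {morph f : x / ~` x}.
  by move=> U; apply: value_uniq (hf _) _; exact: valueC (hf _).
have f0 : f \bot = \bot.
  by apply: value_uniq (hf _) _ => u hu; rewrite ultra0.
split=> //.
- by move=> U V; rewrite -[U `|` V]complK complU fC fI !fC complI !complK.
- by rewrite -compl0 fC f0 compl0.
Qed.

Lemma free_nondegenerate : nondegenerate free.
Proof.
apply/eqP => /(congr1 (fun U : free => val U set0)) /= e.
by suff : (\bot : set (set P)) set0 by []; rewrite e compl0.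
Qed.

(** Lifting the identity along the surjection from the free algebra makes [P] a retract, with [K p]
    a clopen set of value [p]. *)
Lemma projective_section : nondegenerate P -> projective P ->
  exists K : P -> set (set P), [/\ forall p, exists F, depends F (K p),
    forall p, value (K p) p, forall p q, K (p `&` q) = (K p `&` K q)%classic, K \bot = set0 & K \top = setT].
Proof.
move=> Pnd Pproj; have [f fhom fval] := free_value.
have [||k [_ kI _ k0 k1] fk] := Pproj _ free _ P free_nondegenerate Pnd f id fhom.
- move=> p.
  have hp : free_carrier [set v | v p]%classic.
    by exists [:: p] => v v' /(_ p); rewrite inE eqxx => /(_ isT)[].
  by exists (sub_mk hp); apply: value_uniq (fval _) _; exact: value_coord.
- by [].
exists (fun p => val (k p)); split.
- by move=> p; exact: (subP (k p)).
- by move=> p; have := fval (k p); rewrite fk.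
- by move=> p q; rewrite kI.
- by rewrite k0.
- by rewrite k1 /= compl0.
Qed.

End Free.

(** * Projective algebras are rich *)

Section FromProjective.
Context dP (P : ctbDistrLatticeType dP) dB (B : ctbDistrLatticeType dB) (j : P -> B).
Hypotheses (Pnd : nondegenerate P) (Pproj : projective P).
Hypotheses (j_hom : homomorphism j) (j_inj : injective j).
Hypothesis j_dense : forall b, b != \bot -> exists2 p, p != \bot & j p <= b.

Let jI : {morph j : x y / x `&` y}. Proof. by case: j_hom. Qed.
Let jU : {morph j : x y / x `|` y}. Proof. by case: j_hom. Qed.
Let j0 : j \bot = \bot. Proof. by case: j_hom. Qed.
Let j1 : j \top = \top. Proof. by case: j_hom. Qed.

Let j_eq0 p : (j p == \bot) = (p == \bot).
Proof. by rewrite -j0 (inj_eq j_inj). Qed.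

(** [p] is treated as the clopen set [K p]. As closed sets contain the supports of their members, a
    finite meet over [S] is supported inside [S]; its projection is that of the clopen set along the
    coordinates outside the target, which is [W]. *)
Lemma projective_rich : nondegenerate B -> exists ph h, rich j ph h.
Proof.
move=> Bnd; have [K [Kdep Kval KI K0 K1]] := projective_section Pnd Pproj.
have [supp hsupp] := choice Kdep.
pose ph (i : P) (_ : nat) : seq P := ~` i :: supp i.
pose h k : set B := fun b => exists2 p, b = j p & (size (supp p) <= k)%N.
have Kne p : p != \bot -> exists v, K p v.
  move=> /exists_ultra[u hu up]; exists (as_set u).
  by apply/(Kval p _ hu).
have fmP S b : index_closed ph S -> fin_meets j S b -> exists p F,
    [/\ b = j p, forall i, i \in F -> S i & depends F (K p)].
  move=> cS [_ [l lS ->]]; exists (\meet_(i <- l) i); elim: l lS => [|i l IH] lS.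
    exists [::]; rewrite !big_nil; split=> // v v' _.
    by rewrite K1.
  have [|F [e FS hF]] := IH; first by move=> k kl; apply: lS; rewrite inE kl orbT.
  have Si : S i by apply: lS; rewrite mem_head.
  exists (supp i ++ F); rewrite !big_cons jI e; split=> //; last by rewrite KI; exact: dependsI.
  by move=> k; rewrite mem_cat => /orP[ki|/FS//]; apply: (cS i 0%N) => //; rewrite inE ki orbT.
have [vp hvp] : {vp : P -> set P & forall p, p != \bot -> K p (vp p)}.
  apply: (@choice _ _ (fun p v => p != \bot -> K p v)) => p.
  by case: (pselect (p = \bot)) => [->|/eqP/Kne[v Kv]]; [exists set0; rewrite eqxx|exists v].
have genP p : p != \bot -> fin_meets j setT (j p).
  by move=> p0; apply: fin_meets_gen => //; rewrite j_eq0.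
exists ph, h; split.
- by move=> b /j_dense[p p0 pb]; exists (j p) => //; exact: genP.
- split=> [b /fmP[|p [_ [-> _ _]]]|k]; first by [].
    by exists (size (supp p)), p.
  have [N HN] := @conflict_bound P P (fun p i => `[< vp p i >]) k.
  exists N => L hL pL.
  have [L' LE hL'] : exists2 L', L = map j L' & forall p, p \in L' -> p != \bot /\ (size (supp p) <= k)%N.
    elim: L hL {pL} => [|b L IH] hL; first by exists [::].
    have [|L' -> hL'] := IH; first by move=> c cL; apply: hL; rewrite inE cL orbT.
    have [[b0 _] [p bE pk]] := hL b (mem_head _ _).
    exists (p :: L') => [|q]; first by rewrite bE.
    by rewrite inE => /orP[/eqP->|/hL'//]; split=> //; rewrite -j_eq0 -bE.
  rewrite LE size_map; apply: (HN supp); first by apply/allP => p /hL'[].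
  have : all (fun p => p != \bot) L' by apply/allP => p /hL'[].
  move: pL; rewrite LE pairwise_map => pL /sub_in_pairwise; apply; last exact: pL.
  move=> p q p0 q0 /=; rewrite -jI j_eq0 => /eqP pq0.
  apply: contraT => /hasPn nc.
  (* Without a conflict, the chosen points [vp p] and [vp q] glue to a common point of [K p] and
     [K q], although [p] and [q] are disjoint. *)
  pose v : set P := fun i => if i \in supp p then vp p i else vp q i.
  have : K (p `&` q) v.
    rewrite KI; split.
      by apply: (hsupp p) (hvp _ p0) => i ip; rewrite /v ip.
    apply: (hsupp q) (hvp _ q0) => i iq; rewrite /v; case: ifPn => // ip.
    have := nc _ ip; rewrite iq /= negbK => /eqP e.
    by split=> /asboolP; rewrite (e, =^~ e) => /asboolP.
  by rewrite pq0 K0.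
move=> S T t cS cT Tt.
have [t0 [F [tE FT hF]]] := fmP _ _ cT Tt.
pose W : set (set P) := fun v => exists2 v', K t0 v' & forall i, S i -> (v' i <-> v i).
have hW : depends [seq i <- F | `[< S i >]] W.
  move=> v v' vv [v0 Kv0 v0v].
  exists (fun i => if `[< S i >] then v' i else v0 i).
    apply: hF Kv0 => i iF; case: asboolP => // Si; rewrite (v0v _ Si); apply: vv.
    by rewrite mem_filter iF andbT; apply/asboolP.
  by move=> i Si; case: asboolP.
(* The value of [W] uses only literals with index in both [S] and [T], so it belongs to both
   completions. *)
pose good p := sups (fin_meets j S) (j p) /\ sups (fin_meets j T) (j p).
have lit R i : index_closed ph R -> R i -> sups (fin_meets j R) (j i) /\ sups (fin_meets j R) (j (~` i)).
  move=> cR Ri; have Rci : R (~` i) by apply: (cR i 0%N) => //; exact: mem_head.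
  have aux k : R k -> sups (fin_meets j R) (j k).
    move=> Rk; case: (eqVneq (j k) \bot) => [->|k0]; first exact: sups0.
    by apply: sups_in; exact: fin_meets_gen.
  by split; apply: aux.
have [| | | | |w [Sw Tw] wW] := @depends_value _ _ good _ _ _ _ _ _ _ hW.
- by split; rewrite j0; exact: sups0.
- by split; rewrite j1; apply: sups_in; exact: fin_meets1.
- by move=> p q [? ?] [? ?]; split; rewrite jI; apply: supsI => //; exact: fin_meets_meet.
- by move=> p q [? ?] [? ?]; split; rewrite jU; exact: supsU.
- move=> i; rewrite mem_filter => /andP[/asboolP Si /FT Ti].
  by have [? ?] := lit _ _ cS Si; have [? ?] := lit _ _ cT Ti; split.
exists (j w); split=> //.
- have : t0 <= w.
    apply: ultra_leP => u hu; apply/implyP => /(Kval t0 _ hu) Kt.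
    by apply/(wW _ hu); exists (as_set u).
  by move=> /meet_idPl e; rewrite tE -e jI leIr.
(* A point in both [p] and [w] would yield a point of [K t0] with the same coordinates in [S], hence
   also in [K p0]. *)
move=> p Sp; have [p0 [Fp [pE FpS hFp]]] := fmP _ _ cS Sp.
rewrite pE tE -!jI => /eqP; rewrite j_eq0 => /eqP pt0; apply/eqP; rewrite j_eq0; apply/eqP.
apply: ultra_eqP => u hu; rewrite ultra0// ultraI//; apply/negP => /andP[].
move=> /(Kval p0 _ hu) Kp /(wW _ hu)[v Kv vu].
have : K (p0 `&` t0) v.
  by rewrite KI; split=> //; apply: hFp Kp => i /FpS/vu e; split=> /e.
by rewrite pt0 K0.
Qed.

End FromProjective.

(** * Extension of liftings *)

Section Lift.
Context dA (A : ctbDistrLatticeType dA) dB (B : ctbDistrLatticeType dB)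
  dC (C : ctbDistrLatticeType dC).
Context (M : set A) (g : C -> B) (h : A -> B).
Hypotheses (MI : forall a b, M a -> M b -> M (a `&` b))
  (MC : forall a, M a -> M (~` a)).
Hypotheses (g_hom : homomorphism g) (g_surj : forall b, exists c, g c = b).
Hypotheses (hI : forall a b, M a -> M b -> h (a `&` b) = h a `&` h b)
  (hC : forall a, M a -> h (~` a) = ~` h a).
Implicit Types (D E : set A) (k : A -> C) (a b z : A).

Let gI : {morph g : x y / x `&` y}. Proof. by case: g_hom. Qed.
Let gU : {morph g : x y / x `|` y}. Proof. by case: g_hom. Qed.
Let gC : {morph g : x / ~` x}. Proof. by case: g_hom. Qed.

(* A subalgebra of [M] that is relatively complete in [M]. *)
Record rc_subalgebra D : Prop := RcSubalgebra {
  rc0 : D \bot;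
  rcI : forall a b, D a -> D b -> D (a `&` b);
  rcC : forall a, D a -> D (~` a);
  rc_sub : (D `<=` M)%classic;
  rc_proj : forall b, M b -> exists w, [/\ D w, b <= w & forall e, D e -> b <= e -> w <= e] }.

Record lifting D k : Prop := Lifting {
  liftingI : forall a b, D a -> D b -> k (a `&` b) = k a `&` k b;
  liftingC : forall a, D a -> k (~` a) = ~` k a;
  lifting_eq : forall a, D a -> g (k a) = h a }.

Lemma rcU D a b : rc_subalgebra D -> D a -> D b -> D (a `|` b).
Proof.
move=> hD Da Db; rewrite -[_ `|` _]complK complU; apply: (rcC hD).
by apply: (rcI hD); exact: (rcC hD).
Qed.

Lemma liftingU D k a b : rc_subalgebra D -> lifting D k -> D a -> D b -> k (a `|` b) = k a `|` k b.
Proof.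
move=> hD hk Da Db; have [Dca Dcb] := (rcC hD Da, rcC hD Db).
by rewrite -[a `|` b]complK complU (liftingC hk) ?(liftingI hk)// ?(liftingC hk)// ?complI ?complK//; exact: (rcI hD).
Qed.

Lemma lifting_le D k a b : lifting D k -> D a -> D b -> a <= b -> k a <= k b.
Proof. by move=> hk Da Db /meet_idPl e; rewrite leEmeet -(liftingI hk)// e. Qed.

(** Normal form of the elements of the algebra generated by [D] and [z]; the coefficients are not
    unique. *)
Definition adjoin D z : set A := fun a => exists d1 d2, [/\ D d1, D d2 & a = (d1 `&` z) `|` (d2 `&` ~` z)].

Lemma adjoin_old D z : (D `<=` adjoin D z)%classic.
Proof. by move=> a Da; exists a, a; split=> //; ba. Qed.

Lemma adjoin_new D z : rc_subalgebra D -> adjoin D z z.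
Proof.
move=> hD; exists \top, \bot; split; last by ba.
- by rewrite -compl0; apply: (rcC hD); exact: (rc0 hD).
- exact: (rc0 hD).
Qed.

Lemma adjoin_min D E z : rc_subalgebra D -> (D `<=` E)%classic -> E z ->
  (forall a b, E a -> E b -> E (a `&` b)) -> (forall a, E a -> E (~` a)) ->
  (adjoin D z `<=` E)%classic.
Proof.
move=> hD DE Ez EI EC _ [d1 [d2 [/DE E1 /DE E2 ->]]].
rewrite -[_ `|` _]complK complU; apply: (EC); apply: (EI); apply: (EC); apply: (EI) => //.
exact: EC.
Qed.

(** Projections are taken separately on both sides of [z]: the coefficients are the projections of b
    /\ z and b /\ ~z to [D]. *)
Lemma adjoin_rc D z : M z -> rc_subalgebra D -> rc_subalgebra (adjoin D z).
Proof.
move=> Mz hD; split.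
- exact/adjoin_old/(rc0 hD).
- move=> _ _ [a1 [a2 [D1 D2 ->]]] [b1 [b2 [E1 E2 ->]]].
  exists (a1 `&` b1), (a2 `&` b2); split; [exact: (rcI hD)|exact: (rcI hD)|ba].
- move=> _ [a1 [a2 [D1 D2 ->]]].
  exists (~` a1), (~` a2); split; [exact: (rcC hD)|exact: (rcC hD)|ba].
- by apply: adjoin_min => //; exact: (rc_sub hD).
- move=> b Mb; have [w1 [D1 bw1 min1]] := rc_proj hD (MI Mb Mz).
  have [w2 [D2 bw2 min2]] := rc_proj hD (MI Mb (MC Mz)).
  exists ((w1 `&` z) `|` (w2 `&` ~` z)); split; [by exists w1, w2|by ba|].
  move=> _ [e1 [e2 [E1 E2 ->]]] be.
  have h1 : w1 <= e1 by apply: min1 => //; ba.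
  have h2 : w2 <= e2 by apply: min2 => //; ba.
  by ba.
Qed.

(* Sikorski's extension: any [c] over [h z] between the images of the lower and
   the upper projections of [z] will do. *)
Lemma adjoin_lifting D z k : M z -> rc_subalgebra D -> lifting D k ->
  exists k', lifting (adjoin D z) k' /\ forall a, D a -> k' a = k a.
Proof.
move=> Mz hD hk.
have [u [Du zu umin]] := rc_proj hD Mz.
have [l' [Dl' zl' lmin]] := rc_proj hD (MC Mz).
have Dl := rcC hD Dl'.
have ghu a : D a -> z <= a -> h z <= g (k a).
  move=> Da za; rewrite (lifting_eq hk)// leEmeet -hI//; last exact: (rc_sub hD).
  by rewrite (meet_idPl za).
have [c0 gc0] := g_surj (h z).
(* An arbitrary preimage of [h z] is clipped to the required interval; its image under [g] does not
   change. *)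
pose c := (c0 `|` k (~` l')) `&` k u.
have gc : g c = h z.
  rewrite /c gI gU gc0; have h1 := ghu _ Du zu.
  have h2 : g (k (~` l')) <= h z.
    rewrite (lifting_eq hk)// leEmeet -hI//; last exact: (rc_sub hD).
    by apply/eqP; congr h; ba.
  by ba.
have lu : k (~` l') <= k u by apply: (lifting_le hk) => //; ba.
have cu : c <= k u by exact: leIr.
have lc : k (~` l') <= c by rewrite /c lexI leUr lu.
clearbody c.
have up a : D a -> z <= a -> c <= k a.
  by move=> Da za; apply: (le_trans cu); apply: (lifting_le hk) => //; exact: umin.
have dn a : D a -> a <= z -> k a <= c.
  move=> Da az; apply: le_trans lc; apply: (lifting_le hk) => //.
  have h1 : l' <= ~` a by apply: lmin; [exact: (rcC hD)|ba].
  by ba.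
pose val d1 d2 := (k d1 `&` c) `|` (k d2 `&` ~` c).
(* Monotonicity makes the value independent of the coefficients: the hypothesis says z <= ~d1 \/ e1
   and d2 /\ ~e2 <= z, to which [up] and [dn] apply. *)
have val_le d1 d2 e1 e2 : D d1 -> D d2 -> D e1 -> D e2 ->
    (d1 `&` z) `|` (d2 `&` ~` z) <= (e1 `&` z) `|` (e2 `&` ~` z) -> val d1 d2 <= val e1 e2.
  move=> D1 D2 E1 E2 de.
  have h1 : c <= k (~` d1 `|` e1) by apply: up; [apply: rcU => //; exact: (rcC hD)|ba].
  have h2 : k (d2 `&` ~` e2) <= c by apply: dn; [apply: (rcI hD) => //; exact: (rcC hD)|ba].
  move: h1 h2; rewrite (liftingU hD hk) ?(liftingI hk) ?(liftingC hk)//; try exact: (rcC hD).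
  by rewrite /val => h1 h2; clear de; ba.
have [k' hk'] : {k' : A -> C & forall a, adjoin D z a -> exists d1 d2,
    [/\ D d1, D d2, a = (d1 `&` z) `|` (d2 `&` ~` z) & k' a = val d1 d2]}.
  apply: (@choice _ _ (fun a x => adjoin D z a -> exists d1 d2,
    [/\ D d1, D d2, a = (d1 `&` z) `|` (d2 `&` ~` z) & x = val d1 d2])) => a.
  case: (pselect (adjoin D z a)) => [[d1 [d2 [D1 D2 aE]]]|]; last by exists \bot.
  by exists (val d1 d2) => _; exists d1, d2.
have k'E d1 d2 : D d1 -> D d2 -> k' ((d1 `&` z) `|` (d2 `&` ~` z)) = val d1 d2.
  move=> D1 D2; have [|e1 [e2 [E1 E2 e ->]]] := hk' ((d1 `&` z) `|` (d2 `&` ~` z)); first by exists d1, d2.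
  by apply/le_anti/andP; split; apply: val_le => //; rewrite e.
exists k'; split; last first.
  move=> a Da; have -> : k' a = k' ((a `&` z) `|` (a `&` ~` z)) by congr k'; ba.
  by rewrite k'E// /val; ba.
split.
- move=> _ _ [a1 [a2 [D1 D2 ->]]] [b1 [b2 [E1 E2 ->]]].
  have -> : ((a1 `&` z) `|` (a2 `&` ~` z)) `&` ((b1 `&` z) `|` (b2 `&` ~` z)) =
    ((a1 `&` b1) `&` z) `|` ((a2 `&` b2) `&` ~` z) by ba.
  rewrite !k'E//; try exact: (rcI hD).
  by rewrite /val !(liftingI hk)//; ba.
- move=> _ [a1 [a2 [D1 D2 ->]]].
  have -> : ~` ((a1 `&` z) `|` (a2 `&` ~` z)) = (~` a1 `&` z) `|` (~` a2 `&` ~` z) by ba.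
  rewrite !k'E//; try exact: (rcC hD).
  by rewrite /val !(liftingC hk)//; ba.
- move=> _ [a1 [a2 [D1 D2 ->]]]; rewrite k'E// /val gU !gI gC gc !(lifting_eq hk)//.
  have [M1 M2] := (rc_sub hD D1, rc_sub hD D2).
  have Mcz := MC Mz.
  rewrite -[in RHS](complK (_ `|` _)) complU hC; last by apply: MI; apply: MC; exact: MI.
  rewrite hI ?hC ?hI ?hC//; try (by apply: MC; exact: MI); try exact: MI.
  by ba.
Qed.

(** Each single step preserves relative completeness, which is not claimed for the limit [E].
    Minimality of [E] later identifies it as an algebra of finite joins. *)
Lemma lifting_sequence D k (z : nat -> A) : (forall n, M (z n)) ->
    rc_subalgebra D -> lifting D k ->
  exists E k', [/\ lifting E k', (D `<=` E)%classic, (range z `<=` E)%classic,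
    forall E' : set A, (D `<=` E')%classic -> (range z `<=` E')%classic ->
      (forall a b, E' a -> E' b -> E' (a `&` b)) -> (forall a, E' a -> E' (~` a)) ->
      (E `<=` E')%classic &
    [/\ forall a b, E a -> E b -> E (a `&` b), forall a, E a -> E (~` a) &
     forall a, D a -> k' a = k a]].
Proof.
move=> Mz hD hk.
pose T := (set A * (A -> C) * A)%type.
have [f hf] : {f : T -> A -> C & forall t, M t.2 -> rc_subalgebra t.1.1 -> lifting t.1.1 t.1.2 ->
    lifting (adjoin t.1.1 t.2) (f t) /\ forall a, t.1.1 a -> f t a = t.1.2 a}.
  apply: (@choice _ _ (fun (t : T) k' => M t.2 -> rc_subalgebra t.1.1 -> lifting t.1.1 t.1.2 ->
    lifting (adjoin t.1.1 t.2) k' /\ forall a, t.1.1 a -> k' a = t.1.2 a)) => -[[D' k'] x] /=.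
  case: (pselect [/\ M x, rc_subalgebra D' & lifting D' k']) => [[h1 h2 h3]|nh].
    by have [k'' ?] := adjoin_lifting h1 h2 h3; exists k''.
  by exists k' => h1 h2 h3; case: nh.
pose S := fix S n : set A * (A -> C) := if n is n'.+1 then
  (adjoin (S n').1 (z n'), f (S n', z n')) else (D, k).
have hS n : rc_subalgebra (S n).1 /\ lifting (S n).1 (S n).2.
  elim: n => [//|n [IH1 IH2]] /=; split; first exact: adjoin_rc.
  by have [] := hf (S n, z n) (Mz n) IH1 IH2.
have mono n m a : (n <= m)%N -> (S n).1 a -> (S m).1 a /\ (S m).2 a = (S n).2 a.
  elim: m => [|m IH]; first by rewrite leqn0 => /eqP->.
  rewrite leq_eqVlt => /orP[/eqP->//|]; rewrite ltnS => nm /(IH nm)[am <-] /=.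
  split; first exact: adjoin_old.
  by have [_] := hf (S m, z m) (Mz m) (hS m).1 (hS m).2; apply.
pose E : set A := fun a => exists n, (S n).1 a.
have [k' hk'] : {k' : A -> C & forall a, E a -> exists2 n, (S n).1 a & k' a = (S n).2 a}.
  apply: (@choice _ _ (fun a c => E a -> exists2 n, (S n).1 a & c = (S n).2 a)) => a.
  by case: (pselect (E a)) => [[n an]|]; [exists ((S n).2 a) => _; exists n|exists \bot].
have k'E n a : (S n).1 a -> k' a = (S n).2 a.
  move=> an; have [|m am ->] := hk' a; first by exists n.
  have [nm|/ltnW mn] := leqP n m.
    by have [_ ->] := mono _ _ _ nm an.
  by have [_ ->] := mono _ _ _ mn am.
have two a b : E a -> E b -> exists n, (S n).1 a /\ (S n).1 b.
  move=> [n an] [m bm]; exists (maxn n m); split.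
    by have [] := mono n (maxn n m) a (leq_maxl _ _) an.
  by have [] := mono m (maxn n m) b (leq_maxr _ _) bm.
exists E, k'; split.
- split.
  + move=> a b Ea Eb; have [n [an bn]] := two _ _ Ea Eb; have [h1 h2] := hS n.
    by rewrite !(k'E n)// ?(liftingI h2)//; exact: (rcI h1).
  + move=> a [n an]; have [h1 h2] := hS n.
    by rewrite !(k'E n)// ?(liftingC h2)//; exact: (rcC h1).
  + by move=> a [n an]; have [h1 h2] := hS n; rewrite (k'E n)// (lifting_eq h2).
- by move=> a Da; exists 0%N.
- by move=> _ [n _ <-]; exists n.+1; apply: adjoin_new; case: (hS n).
- move=> E' DE' zE' EI EC a [n]; elim: n a => [|n IH] a; first exact: DE'.
  by apply: adjoin_min => //; [case: (hS n)|apply: zE'; exists n].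
split.
- move=> a b Ea Eb; have [n [an bn]] := two _ _ Ea Eb; exists n.
  by have [h1 _] := hS n; exact: (rcI h1).
- by move=> a [n an]; exists n; have [h1 _] := hS n; exact: (rcC h1).
- by move=> a Da; rewrite (k'E 0%N).
Qed.

End Lift.

(** * Projectivity of the algebra of finite joins *)

Section Projective.
Context d (A : ctbDistrLatticeType d) (X : set A) (s : A -> {fset A}).
Hypotheses (And : nondegenerate A) (X0 : forall x, X x -> x != \bot) (X1 : X \top)
  (XI : nonzero_meet_closed X) (XC : forall x, X x -> finite_joins X (~` x))
  (s1 : s \top = fset0) (Xs : coherent_finite_separation X s).
Implicit Types (Y Z : set A).

Local Notation J := finite_joins.

Record good Y : Prop := Good {
  good_sub : (Y `<=` X)%classic;
  good1 : Y \top;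
  goodI : nonzero_meet_closed Y;
  goodC : forall y, Y y -> J Y (~` y);
  good_s : forall y c, Y y -> c \in s y -> Y c }.

(** Joins are projected termwise, so one [x] in [X] suffices. The complement of an upper bound of
    [x] in [J Y] is a join of members [y] of [Y] disjoint from [x]; the separator above [y] belongs
    to [s x], and to [Y] because it also belongs to [s y]. *)
Lemma good_rc Y : good Y -> rc_subalgebra (J X) (J Y).
Proof.
move=> hY; have JC a : J Y a -> J Y (~` a).
  by apply: finite_joinsC; [exact: good1|exact: goodI|exact: goodC].
split=> //.
- exact: finite_joins0.
- by move=> a b; apply: finite_joinsI; exact: goodI.
- by move=> a; apply: finite_joins_mono => y /(good_sub hY); exact: finite_joins_in.
apply: finite_joins_ind => [|x b Xx [w [Jw bw wmin]]].
  by exists \bot; split=> //; exact: finite_joins0.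
suff [v [Jv xv vmin]] : exists v, [/\ J Y v, x <= v & forall e, J Y e -> x <= e -> v <= e].
  exists (v `|` w); split; [exact: finite_joinsU|by rewrite leU2|].
  by move=> e Je; rewrite !leUx => /andP[/(vmin _ Je)-> /(wmin _ Je)->].
pose ds := [seq c <- s x | `[< Y c >] && (c `&` x == \bot)].
exists (~` (\join_(c <- ds) c)); split.
- apply: JC; exists ds => // c; rewrite mem_filter => /andP[/andP[/asboolP Yc _] _].
  exact: Yc.
- apply: ultra_leP => u hu; apply/implyP => ux; rewrite ultraC// ultra_joins//.
  apply/hasPn => c; rewrite mem_filter => /andP[/andP[_ /eqP cx] _].
  by apply/negP => uc; have := ultraI hu c x; rewrite cx ultra0// uc ux.
move=> e Je xe; rewrite leCx; case: (JC _ Je) => l lY eE.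
rewrite eE; apply/joinsP_seq => y yl _.
have ye : y <= ~` e by rewrite eE; apply: joins_sup_seq yl _ => //.
have xy : x `&` y = \bot by ba.
have [c [c' [+ + cc xc yc']]] := Xs.1.2 _ _ Xx (good_sub hY (lY _ yl)) xy.
rewrite !inE => _ /andP[c'x c'y]; apply: le_trans yc' _.
apply: joins_sup_seq => //; rewrite mem_filter c'x andbT; apply/andP; split.
  by apply/asboolP; exact: (good_s hY (lY _ yl)).
by ba.
Qed.

Definition meet_sets Y Z : set A := fun a => a != \bot /\ exists y z, [/\ Y y, Z z & a = y `&` z].

Lemma meet_sets_l Y Z y : good Y -> Z \top -> Y y -> meet_sets Y Z y.
Proof.
by move=> hY Z1 Yy; split; [apply/X0/(good_sub hY)|exists y, \top; rewrite meetx1].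
Qed.

Lemma meet_sets_r Y Z z : good Z -> Y \top -> Z z -> meet_sets Y Z z.
Proof.
by move=> hZ Y1 Zz; split; [apply/X0/(good_sub hZ)|exists \top, z; rewrite meet1x].
Qed.

(** Closure under [s] is where coherence enters: the value at y /\ z consists of meets of members of
    [s y] and [s z]. *)
Lemma meet_sets_good Y Z : good Y -> good Z -> good (meet_sets Y Z).
Proof.
move=> hY hZ.
have [Y1 Z1] := (good1 hY, good1 hZ).
have YZI : nonzero_meet_closed (meet_sets Y Z).
  move=> a b [a0 [y [z [Yy Zz aE]]]] [b0 [y' [z' [Yy' Zz' bE]]]] ab0; split=> //.
  exists (y `&` y'), (z `&` z'); split; last by rewrite aE bE; ba.
  + by apply: (goodI hY) => //; apply: contra_neq ab0 => e; rewrite aE bE; ba.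
  + by apply: (goodI hZ) => //; apply: contra_neq ab0 => e; rewrite aE bE; ba.
split.
- move=> a [a0 [y [z [/(good_sub hY) Xy /(good_sub hZ) Xz aE]]]].
  by rewrite {}aE in a0 *; exact: XI.
- exact: meet_sets_l.
- exact: YZI.
- move=> a [a0 [y [z [Yy Zz ->]]]]; rewrite complI; apply: finite_joinsU.
    by apply: finite_joins_mono (goodC hY Yy) => x Yx; apply: finite_joins_in; exact: meet_sets_l.
  by apply: finite_joins_mono (goodC hZ Zz) => x Zx; apply: finite_joins_in; exact: meet_sets_r.
- move=> a c [a0 [y [z [Yy Zz aE]]]]; rewrite {}aE in a0 *.
  move=> /(Xs.2 _ _ (good_sub hY Yy) (good_sub hZ Zz) a0)[c0 [G [_ GF cE]]].
  have GYZ x : x \in enum_fset G -> meet_sets Y Z x.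
    move=> /(fsubsetP GF); rewrite inE => /orP[/(good_s hY Yy)|/(good_s hZ Zz)].
      exact: meet_sets_l.
    exact: meet_sets_r.
  rewrite {}cE in c0 *; move: GYZ c0; elim: (enum_fset G) => [|x m IHm] mYZ m0.
    by rewrite big_nil; exact: meet_sets_l.
  rewrite big_cons in m0 *; apply: (YZI) (m0); first exact: (mYZ _ (mem_head _ _)).
  apply: IHm => [v vm|]; first by apply: mYZ; rewrite inE vm orbT.
  by apply: contra_neq m0 => ->; rewrite meetx0.
Qed.

(** Countable closure under [s], under the joinands of complements and under non-zero binary
    meets. *)
Lemma good_countable x : X x -> exists z : nat -> A, good (range z) /\ range z x.
Proof.
move=> Xx.
have [de hde] : {de : A -> seq A & forall x, X x -> (forall y, y \in de x -> X y) /\ ~` x = \join_(y <- de x) y}.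
  apply: (@choice _ _ (fun x l => X x -> (forall y, y \in l -> X y) /\ ~` x = \join_(y <- l) y)) => y.
  by case: (pselect (X y)) => [/XC[l lX yE]|]; [exists l|exists [::]].
(* Missing entries are read as top, so the empty list produces top itself. *)
pose ab (l : seq A) := head \top l `&` head \top (behead l).
pose F (l : seq A) (_ : nat) : seq A := (s (head \top l) : seq A) ++ de (head \top l) ++
  (if ab l == \bot then [::] else [:: ab l]).
have [z [zx zF zQ]] := countable_closure x F.
have zX n : X (z n).
  apply: (zQ X) => // l n' j lX.
  have X_head : X (head \top l) by case: l lX => [|y l] // lX; apply: lX; exact: mem_head.
  have X_head2 : X (head \top (behead l)).
    by case: l lX {X_head} => [|y [|y' l]] // lX; apply: lX; rewrite !inE eqxx orbT.
  rewrite !mem_cat => /or3P[js|jd|].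
  - exact: (Xs.1.1 _ X_head).
  - exact: (hde _ X_head).1.
  - by case: eqVneq => // ab0; rewrite inE => /eqP ->; exact: XI.
have in1 y : range z y -> forall i, i \in [:: y] -> range z i by move=> zy i; rewrite inE => /eqP->.
exists z; split=> //; split.
- by move=> _ [n _ <-].
- apply: (zF [::] 0%N) => //; rewrite !mem_cat /ab /= meetxx ifF ?inE ?eqxx ?orbT//.
  by apply/negbTE; exact: X0.
- move=> y y' zy zy' yy0; apply: (zF [:: y; y'] 0%N).
    by move=> i; rewrite !inE => /orP[/eqP->|/eqP->].
  by rewrite !mem_cat /ab /= (negbTE yy0) inE eqxx !orbT.
- move=> y zy; have Xy : X y by case: zy => n _ <-.
  have [_ ->] := hde _ Xy; exists (de y) => // c cy.
  by apply: (zF [:: y] 0%N); [exact: in1|rewrite !mem_cat cy orbT].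
- move=> y c zy cy; apply: (zF [:: y] 0%N); first exact: in1.
  by rewrite !mem_cat cy.
Qed.

Section LiftAll.
Context dB (B : ctbDistrLatticeType dB) dC (C : ctbDistrLatticeType dC).
Context (g : C -> B) (h : A -> B).
Hypotheses (g_hom : homomorphism g) (g_surj : forall b, exists c, g c = b).
Hypotheses (hI : forall a b, J X a -> J X b -> h (a `&` b) = h a `&` h b)
  (hC : forall a, J X a -> h (~` a) = ~` h a).

Let JXC a : J X a -> J X (~` a). Proof. exact: finite_joinsC. Qed.
Let JXI a b : J X a -> J X b -> J X (a `&` b). Proof. exact: finite_joinsI. Qed.

(** The lifting is extended along an enumeration of a countable good set containing [x]. The algebra
    reached consists of the finite joins of products of [Y] and [range z], which form a good set; so
    [good_rc] makes it relatively complete again. *)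
Lemma good_extend Y (k : A -> C) x : good Y -> lifting g h (J Y) k -> X x ->
  exists Z k', [/\ good Z, lifting g h (J Z) k', (Y `<=` Z)%classic, Z x &
    forall a, J Y a -> k' a = k a].
Proof.
move=> hY hk Xx; have [z [hz zx]] := good_countable Xx.
have JYX Z a : good Z -> J Z a -> J X a.
  by move=> hZ; apply: finite_joins_mono => y /(good_sub hZ); exact: finite_joins_in.
have [|E [k' [hk' YE zE Emin [EI EC k'k]]]] :=
  lifting_sequence JXI JXC g_hom g_surj hI hC (z := z) _ (good_rc hY) hk.
  by move=> n; apply: (JYX _ _ hz); apply: finite_joins_in; exists n.
have hZ := meet_sets_good hY hz; have [Y1 z1] := (good1 hY, good1 hz).
have EZ : E = J (meet_sets Y (range z)).
  apply/seteqP; split.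
    apply: Emin.
    - by move=> a; apply: finite_joins_mono => y Yy; apply: finite_joins_in; exact: meet_sets_l.
    - by move=> y zy; apply: finite_joins_in; exact: meet_sets_r.
    - by move=> a b; apply: finite_joinsI; exact: (goodI hZ).
    - by move=> a; apply: finite_joinsC; [exact: (good1 hZ)|exact: (goodI hZ)|exact: (goodC hZ)].
  apply: finite_joins_ind => [|a b [_ [y [v [Yy zv ->]]]] Eb].
    by apply: YE; exact: finite_joins0.
  rewrite -[_ `|` b]complK complU; apply: (EC); apply: (EI); apply: (EC) => //.
  by apply: EI; [apply: YE; exact: finite_joins_in|exact: zE].
exists (meet_sets Y (range z)), k'; split=> //; first by rewrite -EZ.
- by move=> y Yy; exact: meet_sets_l.
- exact: meet_sets_r.
Qed.

(** Zorn's lemma on liftings over good sets, starting from the two-element algebra; [s1] makes the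
    singleton of top good. *)
Lemma lift_all : exists k : A -> C, lifting g h (J X) k.
Proof.
have gd : good [set \top]%classic.
  split.
  - by move=> _ ->.
  - by [].
  - by move=> _ _ -> -> _; rewrite /= meetxx.
  - by move=> _ ->; rewrite compl1; exact: finite_joins0.
  - by move=> _ c ->; rewrite s1.
have J1 a : J [set \top]%classic a -> a = \bot \/ a = \top.
  by move: a; apply: finite_joins_ind => [|a b ->]; [left|right; rewrite join1x].
have hinit : lifting g h (J [set \top]%classic) (fun a => if a == \bot then \bot else \top).
  have T1 : \top != \bot :> A by rewrite eq_sym.
  have J1X a : a = \bot \/ a = \top -> J X a.
    by move=> [->|->]; [exact: finite_joins0|exact: finite_joins_in].
  have g0 : g \bot = \bot by case: g_hom.
  have g1 : g \top = \top by case: g_hom.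
  have h0 : h \bot = \bot.
    have JX0 := finite_joins0 X.
    have := hI JX0 (JXC JX0); rewrite hC// => e.
    by rewrite meet0x in e; rewrite e meetxC.
  have h1 : h \top = \top by rewrite -compl0 hC ?h0 ?compl0//; exact: finite_joins0.
  split.
  - by move=> a b /J1[->|->] /J1[->|->]; rewrite ?meet0x ?meetx0 ?meet1x ?eqxx ?(negbTE T1) ?meet0x ?meetx0 ?meet1x.
  - by move=> a /J1[->|->]; rewrite ?compl0 ?compl1 ?eqxx ?(negbTE T1) ?compl0 ?compl1.
  - by move=> a /J1[->|->]; rewrite ?eqxx ?(negbTE T1) ?h0 ?h1.
pose ok (t : set A * (A -> C)) := good t.1 /\ lifting g h (J t.1) t.2.
pose T := {t : set A * (A -> C) | `[< ok t >]}.
have TP (t : T) : ok (val t) by exact/asboolP/(valP t).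
pose mk t (ht : ok t) : T := exist _ t (asboolT ht).
pose le (t u : T) := ((val t).1 `<=` (val u).1)%classic /\
  forall a, J (val t).1 a -> (val u).2 a = (val t).2 a.
have le_refl t : le t t by split.
have JJ t u a : le t u -> J (val t).1 a -> J (val u).1 a.
  by move=> [tu _]; apply: finite_joins_mono => y /tu; exact: finite_joins_in.
pose R (t u : T) : bool := `[< le t u >].
have oki : ok ([set \top]%classic, fun a => if a == \bot then \bot else \top) by split.
have [| | |t tmax] := @ZL_preorder T (mk _ oki) R.
- by move=> t; apply/asboolP; exact: le_refl.
- move=> t u v /asboolP tu /asboolP[uv h2]; apply/asboolP; split.
  + by case: tu => tu _ a /tu/uv.
  + by move=> a ta; rewrite h2; [case: tu => _; exact|exact: JJ ta].
- move=> F Ftot.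
  case: (pselect (exists t, F t)) => [[t0 Ft0]|nF]; last first.
    by exists (mk _ oki) => t Ft; case: nF; exists t.
  pose Y := (\bigcup_(t in F) (val t).1)%classic.
  have two t u : F t -> F u -> exists v, [/\ F v, le t v & le u v].
    move=> Ft Fu; have [/asboolP tu|/asboolP ut] := Ftot _ _ Ft Fu.
    + by exists u; split=> //; exact: le_refl.
    + by exists t; split=> //; exact: le_refl.
  have YJ a : J Y a -> exists2 t, F t & J (val t).1 a.
    move: a; apply: finite_joins_ind => [|a b [t Ft ta] [u Fu ub]].
      by exists t0 => //; exact: finite_joins0.
    have [v [Fv tv uv]] := two _ _ Ft Fu; exists v => //.
    by apply: finite_joinsU; [apply: (JJ _ _ _ tv); exact: finite_joins_in|exact: JJ ub].
  have YJ2 a b : J Y a -> J Y b -> exists t, [/\ F t, J (val t).1 a & J (val t).1 b].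
    move=> /YJ[t Ft ta] /YJ[u Fu ub]; have [v [Fv tv uv]] := two _ _ Ft Fu.
    by exists v; split=> //; [exact: JJ ta|exact: JJ ub].
  have [k hk] : {k : A -> C & forall a, J Y a -> exists t, [/\ F t, J (val t).1 a & k a = (val t).2 a]}.
    apply: (@choice _ _ (fun a c => J Y a -> exists t, [/\ F t, J (val t).1 a & c = (val t).2 a])) => a.
    by case: (pselect (J Y a)) => [/YJ[t Ft ta]|]; [exists ((val t).2 a) => _; exists t|exists \bot].
  have tY t : F t -> forall a, J (val t).1 a -> J Y a.
    by move=> Ft a; apply: finite_joins_mono => y ty; apply: finite_joins_in; exists t.
  have kE t a : F t -> J (val t).1 a -> k a = (val t).2 a.
    move=> Ft ta; have [u [Fu ua ->]] := hk _ (tY _ Ft _ ta).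
    by have [v [Fv [_ h1] [_ h2]]] := two _ _ Ft Fu; rewrite -h1// -h2.
  have two' y y' : Y y -> Y y' -> exists t, [/\ F t, (val t).1 y & (val t).1 y'].
    move=> [t Ft ty] [u Fu uy']; have [v [Fv [tv _] [uv _]]] := two _ _ Ft Fu.
    by exists v; split=> //; [exact: tv|exact: uv].
  have okY : ok (Y, k).
    split; split.
    + by move=> y [t Ft ty]; exact: (good_sub (TP t).1).
    + by exists t0 => //; exact: (good1 (TP t0).1).
    + move=> y y' Yy Yy' yy0; have [t [Ft ty ty']] := two' _ _ Yy Yy'.
      by exists t => //; exact: (goodI (TP t).1).
    + by move=> y [t Ft ty]; apply: (tY _ Ft); exact: (goodC (TP t).1).
    + by move=> y c [t Ft ty] cy; exists t => //; exact: (good_s (TP t).1 ty).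
    + move=> a b Ya Yb; have [t [Ft ta tb]] := YJ2 _ _ Ya Yb; have [ht lt] := TP t.
      rewrite /= !(kE t)// ?(liftingI lt)//.
      by apply: finite_joinsI => //; exact: (goodI ht).
    + move=> a /YJ[t Ft ta]; have [ht lt] := TP t.
      rewrite /= !(kE t)// ?(liftingC lt)//.
      by apply: finite_joinsC => //; [exact: (good1 ht)|exact: (goodI ht)|exact: (goodC ht)].
    + by move=> a /YJ[t Ft ta]; have [ht lt] := TP t; rewrite /= (kE t)// (lifting_eq lt).
  exists (mk _ okY) => t Ft; apply/asboolP; split; first by move=> y ty; exists t.
  by move=> a ta; exact: kE.
have [ht lt] := TP t; exists (val t).2.
have XE : (val t).1 = X.
  apply/seteqP; split=> [|x Xx]; first exact: (good_sub ht).
  have [Z [k' [hZ hk' tZ Zx k'k]]] := good_extend ht lt Xx.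
  have okZ : ok (Z, k') by split.
  have /asboolP[h1 _] : R (mk _ okZ) t by apply: tmax; apply/asboolP.
  exact: h1.
by rewrite -XE.
Qed.

End LiftAll.

Definition base_algebra : subalgebra A :=
  @Subalgebra _ A (J X) (finite_joins0 X) (fun a b => finite_joinsI XI)
    (fun a => finite_joinsC X1 XI XC).

Lemma finite_joins_projective : projective (subalg base_algebra).
Proof.
move=> dC C dB B _ _ g h g_hom g_surj h_hom.
(* [h] is continued by bottom outside the finite joins, as [lift_all] works with functions on all of
   [A]. *)
pose h' (a : A) : B := if pselect (J X a) is left Ja then h (@sub_mk _ _ base_algebra a Ja) else \bot.
have h'E (p : subalg base_algebra) : h' (val p) = h p.
  rewrite /h'; case: pselect => [Ja|[]]; last exact: (subP p).
  by congr h; exact: val_inj.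
have mk a : J X a -> exists p : subalg base_algebra, val p = a.
  by move=> Ja; exists (@sub_mk _ _ base_algebra a Ja).
have [hU hI hC h0 h1] := h_hom.
have [| |k [kI kC kE]] := @lift_all _ B _ C g h' g_hom g_surj.
- by move=> _ _ /mk[p <-] /mk[q <-]; rewrite !h'E -hI -h'E.
- by move=> _ /mk[p <-]; rewrite !h'E -hC -h'E.
have JX0 := finite_joins0 X.
have k0 : k \bot = \bot.
  have := kI _ _ JX0 (finite_joinsC X1 XI XC JX0); rewrite kC// meet0x => e.
  by rewrite e meetxC.
exists (fun p => k (val p)); last by move=> p; rewrite kE ?h'E//; exact: (subP p).
split=> [p q|p q|p||] /=.
- have [Jp Jq] := (subP p, subP q).
  rewrite -[val p `|` val q]complK complU kC ?kI ?kC ?complI ?complK//;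
  by do ?[exact: finite_joinsC|apply: finite_joinsI].
- by apply: kI; exact: (@subP _ _ base_algebra).
- by apply: kC; exact: (@subP _ _ base_algebra).
- exact: k0.
- by rewrite kC// k0 compl0.
Qed.

End Projective.

(** * Weakly projective algebras *)

Lemma homomorphism_comp dA (A : ctbDistrLatticeType dA) dB (B : ctbDistrLatticeType dB)
    dC (C : ctbDistrLatticeType dC) (f : A -> B) (g : B -> C) :
  homomorphism f -> homomorphism g -> homomorphism (g \o f).
Proof.
move=> [fU fI fC f0 f1] [gU gI gC g0 g1]; split=> [x y|x y|x||] /=;
by rewrite ?fU ?fI ?fC ?f0 ?f1.
Qed.

Lemma homomorphism_le dA (A : ctbDistrLatticeType dA) dB (B : ctbDistrLatticeType dB)
    (f : A -> B) x y : homomorphism f -> x <= y -> f x <= f y.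
Proof. by move=> [_ fI _ _ _] /meet_idPl e; rewrite leEmeet -fI e. Qed.

(** Through the isomorphism of completions [A] embeds densely in the completion [B] of [P], which is
    rich with the elements of [P] as generators. *)
Lemma weakly_projective_base d (A : ctbDistrLatticeType d) :
    nondegenerate A -> weakly_projective A ->
  exists (X : set A) (s : A -> {fset A}),
    [/\ pi_base X, nonzero_meet_closed X & coherent_finite_separation X s].
Proof.
move=> And [dP [P [Pnd Pproj [dA' [A' [eA [dB [B [eB]]]]]]]]].
move=> [[_ eA_hom eA_inj [_ eA_dense]] [_ eB_hom eB_inj [_ eB_dense]]].
move=> [f f_hom f_bij]; have [f' f'K fK] := f_bij.
have f0 : f \bot = \bot by case: f_hom.
have io_hom := homomorphism_comp eA_hom f_hom.
have io_inj : injective (f \o eA) by apply: inj_comp => //; exact: bij_inj.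
have Bnd : nondegenerate B.
  rewrite /nondegenerate; have [_ _ _ <- <-] := io_hom.
  by apply: contra_neq And => /io_inj.
have io_dense b : b != \bot -> exists2 a, a != \bot & (f \o eA) a <= b.
  move=> b0; have b'0 : f' b != \bot by apply: contra_neq b0 => e; rewrite -(fK b) e.
  have [_ [a a0 <-] ab] := eA_dense _ b'0; exists a => //.
  by rewrite -(fK b); exact: (homomorphism_le f_hom ab).
have eB_dense' b : b != \bot -> exists2 p, p != \bot & eB p <= b.
  by move=> /eB_dense[_ [p p0 <-] pb]; exists p.
have [ph [h hrich]] := projective_rich Pnd Pproj eB_hom eB_inj eB_dense' Bnd.
have [X [s [h1 _ h2 _ h3]]] := exists_base hrich Bnd io_hom io_inj io_dense And.
by exists X, s.
Qed.

(** The finite joins of a complemented base form a projective algebra. It is dense in [A], so the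
    completion of [A] is a completion of both. *)
Lemma base_weakly_projective d (A : ctbDistrLatticeType d) (X : set A) (s : A -> {fset A}) :
    nondegenerate A -> pi_base X -> nonzero_meet_closed X ->
    coherent_finite_separation X s -> weakly_projective A.
Proof.
move=> And Xb XI Xs.
have [Y [r [[Y0 Yd] Y1 YI YC [r1 Yr]]]] := exists_complemented_base And Xb XI Xs.
pose P := subalg (base_algebra Y1 YI YC).
have val_hom := val_hom (base_algebra Y1 YI YC).
have [_ _ _ b0 b1] := below_hom A.
exists d, P; split.
- by apply/eqP => /(congr1 val); case: val_hom => _ _ _ -> ->; apply/eqP.
- exact: (finite_joins_projective And Y0 r1 Yr).
exists d, (completion A), (@below _ A), d, (completion A), (@below _ A \o val).
split.
- split.
  + exact: completion_complete.
  + exact: below_hom.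
  + exact: below_inj.
  split=> [_ [a a0 <-]|c /below_dense[a a0 ac]]; last by exists (below a) => //; exists a.
  by rewrite -b0 (inj_eq (@below_inj _ A)).
- split.
  + exact: completion_complete.
  + exact: homomorphism_comp val_hom (below_hom A).
  + by apply: inj_comp; [exact: below_inj|exact: val_inj].
  split=> [_ [p p0 <-]|c /below_dense[a /Yd[y Yy ya] ac]].
    rewrite -b0 (inj_eq (@below_inj _ A)); apply: contra_neq p0 => e.
    by apply: val_inj; rewrite e; case: val_hom => _ _ _ ->.
  have Jy : base_algebra Y1 YI YC y by exact: finite_joins_in.
  exists (below y); last by apply: le_trans ac; exact: (homomorphism_le (below_hom A)).
  exists (sub_mk Jy) => //=; apply/eqP => /(congr1 val).
  by case: val_hom => _ _ _ -> _ /= y0; have := Y0 _ Yy; rewrite y0 eqxx.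
exists id; last by exists id.
by split.
Qed.

Theorem theoremB (d : Order.disp_t) (A : ctbDistrLatticeType d)
    (hA : nondegenerate A) :
  weakly_projective A <->
  exists X : set A,
    [/\ pi_base X, nonzero_meet_closed X &
        exists s : A -> {fset A}, coherent_finite_separation X s].
Proof.
split=> [/(weakly_projective_base hA)[X [s [h1 h2 h3]]]|[X [h1 h2 [s h3]]]].
  by exists X; split=> //; exists s.
exact: base_weakly_projective h3.
Qed.
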